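(* Let $k>\ell\ge 2$ be integers such that $(k-\ell)\nmid k$, let $s=\lceil\frac{k}{k-\ell}\rceil$, and let $s_*=s_*(k)$ be a function of $k$. There exists $\Delta_0>0$ such that for every $0<\Delta\le\Delta_0$ the following holds for all sufficiently large $n\in(k-\ell)\mathbb{N}$. Let $\mathcal{H}=(V,E)$ be an $n$-vertex $k$-graph which is $\Delta$-extremal and satisfies $\delta_{k-1}(\mathcal{H})\ge\frac{n}{s(k-\ell)}$. Let $V=A\cup B$ be a partition with $|B|=\left\lfloor\left(1-\frac{1}{s(k-\ell)}\right)n\right\rfloor$ and with $e(B)$ smallest among all such partitions, let $A',B',V_0$ be the associated vertex classes defined in the context, and let $q=|A\cap B'|$. If $\mathcal{H}[B']$ contains $sq$ vertex-disjoint $\ell$-paths $P_1,P_2,\ldots,P_{sq}$, each of length at most $s_*$ and each having both of its $\ell$-ends linkable, then $\mathcal{H}$ contains a Hamilton $\ell$-cycle.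
   Context: A $k$-graph $\mathcal{H}=(V,E)$ has a finite vertex set $V$ and $E\subseteq\binom{V}{k}$; $\delta_{k-1}(\mathcal{H})$ is the minimum, over all $(k-1)$-sets $S\subseteq V$, of the number of $v\in V\setminus S$ with $S\cup\{v\}\in E$. For $B\subseteq V$, $e(B)$ is the number of edges contained in $B$. $\mathcal{H}$ on $n$ vertices is $\Delta$-extremal if there is $B\subseteq V$ with $|B|=\left\lfloor\left(1-\frac{1}{s(k-\ell)}\right)n\right\rfloor$ and $e(B)\le\Delta n^k$. For $X,Z\subseteq V$ with $|X|<k$, $\deg(X,Z)$ is the number of $(k-|X|)$-sets $Y\subseteq Z$ with $X\cup Y\in E$. Constants: $\varepsilon_0=2k!\,\Delta\left(1-\frac{1}{s(k-\ell)}\right)^{-k}$ and $\varepsilon_1=\varepsilon_0^{1/4}$. Given the partition $V=A\cup B$, define $A'=\{v\in V:\deg(v,B)\ge(1-\varepsilon_1)\binom{|B|}{k-1}\}$, $B'=\{v\in V:\deg(v,B)\le\varepsilon_1\binom{|B|}{k-1}\}$, and $V_0=V\setminus(A'\cup B')$. For $0\le\ell'\le\ell$, an $\ell'$-set $L'\subseteq V$ is $\varepsilon_1$-bad if $\deg(L',B)>\varepsilon_1\binom{|B|}{k-\ell'}$, and $\varepsilon_1$-good otherwise. An ordered $\ell$-set $(v_1,\dots,v_\ell)$ is linkable if for every $i\in\{1,\dots,s-1\}$ the $(\ell-(i-1)(k-\ell))$-set $\{v_{(i-1)(k-\ell)+1},v_{(i-1)(k-\ell)+2},\dots,v_\ell\}$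 is $\varepsilon_1$-good. A ($k$-uniform) $\ell$-path is a $k$-graph whose vertices can be linearly ordered as $v_1v_2\dots v_t$ so that every edge consists of $k$ consecutive vertices and two consecutive edges share exactly $\ell$ vertices; its length is its number of edges (at least one). Its two $\ell$-ends, read outward, are the ordered $\ell$-sets $(v_\ell,v_{\ell-1},\dots,v_1)$ and $(v_{t-\ell+1},\dots,v_{t-1},v_t)$. An $\ell$-cycle is defined in the same way with a cyclic ordering, and a Hamilton $\ell$-cycle in $\mathcal{H}$ is a spanning subhypergraph that is an $\ell$-cycle. $\mathcal{H}[B']$ is the subhypergraph induced on $B'$. *)

(* Defs.v *)
From HB Require Import structures.
From mathcomp Require Import all_boot all_order all_algebra.
From mathcomp Require Import reals exp.

Set Implicit Arguments.
Unset Strict Implicit.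
Unset Printing Implicit Defensive.

Import Order.TTheory GRing.Theory Num.Theory.

Definition ceil_div (a b : nat) : nat := (a + b.-1) %/ b.

Definition s_of (k l : nat) : nat := ceil_div k (k - l).

(* A k-graph on the vertex set V (a finType) is given by its edge set E. *)
Definition kgraph (V : finType) (k : nat) (E : {set {set V}}) : Prop :=
  {in E, forall e : {set V}, #|e| = k}.

Section Hypergraph.

Variables (V : finType) (k l : nat) (E : {set {set V}}).

Definition deg (X Z : {set V}) : nat :=
  #|[set Y : {set V} | [&& Y \subset Z, #|Y| == k - #|X| & X :|: Y \in E]]|.

Definition codeg (S : {set V}) : nat :=
  #|[set v : V | (v \notin S) && (v |: S \in E)]|.

(* The default value #|V| bounds every codegree, so this is the true minimum
   as soon as V has at least k - 1 elements. *)
Definition min_codeg : nat :=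
  \big[minn/#|V|]_(S : {set V} | #|S| == k.-1) codeg S.

Definition induced (W : {set V}) : {set {set V}} := [set e in E | e \subset W].

Definition nedges (W : {set V}) : nat := #|induced W|.

Section Thresholds.

Variable R : realType.
Local Open Scope ring_scope.

(* 1 - 1 / (s (k - l)) *)
Definition density : R := 1 - (s_of k l * (k - l))%:R^-1.

Definition has_B_size (B : {set V}) : Prop :=
  (#|B|%:Z = Num.floor (density * #|V|%:R))%R.

Definition extremal (Delta : R) : Prop :=
  exists2 B : {set V},
    has_B_size B & (nedges B)%:R <= Delta * #|V|%:R ^+ k.

Definition eps0 (Delta : R) : R := 2 * (k`!)%:R * Delta * density ^- k.

Definition eps1 (Delta : R) : R := powR (eps0 Delta) (4%:R^-1).

Variables (eps : R) (B : {set V}).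

Definition A' : {set V} :=
  [set v | (1 - eps) * 'C(#|B|, k.-1)%:R <= (deg [set v] B)%:R].

Definition B' : {set V} :=
  [set v | (deg [set v] B)%:R <= eps * 'C(#|B|, k.-1)%:R].

Definition V0 : {set V} := ~: (A' :|: B').

Definition bad (L : {set V}) : bool :=
  eps * 'C(#|B|, k - #|L|)%:R < (deg L B)%:R.

Definition good (L : {set V}) : bool := ~~ bad L.

(* w = (v_1, ..., v_l); the set {v_{(i-1)(k-l)+1}, ..., v_l} consists of the
   entries of w left after dropping the first (i-1)(k-l) of them. *)
Definition linkable (w : seq V) : Prop :=
  [/\ size w = l, uniq w
    & forall i : nat, (1 <= i <= (s_of k l).-1)%N ->
        good [set x in drop (i.-1 * (k - l)) w]].

End Thresholds.

(* An l-path is represented by its vertex ordering p = (v_1, ..., v_t).  Its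
   edges cover p from its first to its last vertex, and two consecutive edges
   share exactly l vertices, so that with m edges t = l + m (k - l) and the
   i-th edge (0 <= i < m) consists of the k entries from position i (k - l) on. *)
Definition path_edge (p : seq V) (i : nat) : {set V} :=
  [set x in take k (drop (i * (k - l)) p)].

Definition path_length (p : seq V) : nat := (size p - l) %/ (k - l).

Definition is_lpath (p : seq V) : Prop :=
  [/\ uniq p, 0 < path_length p & size p = l + path_length p * (k - l)].

Definition path_end_left (p : seq V) : seq V := rev (take l p).

Definition path_end_right (p : seq V) : seq V := drop (size p - l) p.

Definition contains_lpath (F : {set {set V}}) (W : {set V}) (p : seq V) : Prop :=
  [/\ is_lpath p, {subset p <= W}
    & forall i : nat, i < path_length p -> path_edge p i \in F].

(* The same for a cyclic ordering c of all of V: there are #|V| / (k - l)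
   edges, and consecutive ones (cyclically) share exactly l vertices as soon as
   #|V| >= 2k - l. *)
Definition cycle_edge (c : seq V) (i : nat) : {set V} :=
  [set x in take k (rot (i * (k - l)) c)].

Definition hamilton_lcycle : Prop :=
  exists c : seq V,
    [/\ uniq c, c =i V, (k - l) %| size c
      & forall i : nat, i < size c %/ (k - l) -> cycle_edge c i \in E].

End Hypergraph.

(* Main.v *)
Require Import Defs.
From HB Require Import structures.
From mathcomp Require Import all_boot all_order all_algebra.
From mathcomp Require Import fingroup perm.
From mathcomp Require Import reals exp.
From mathcomp Require Import zify ring lra.

Set Implicit Arguments.
Unset Strict Implicit.
Unset Printing Implicit Defensive.

Import Order.TTheory GRing.Theory Num.Theory.

(** Put d = k - l and s = s_of k l, so that (s - 1) d < k < s d: an l-path in which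
    every (s d)-th vertex is chosen suitably has exactly one such vertex in each
    edge.  By minimality of e(B) and the codegree condition, almost all k-sets
    with one vertex in A' and the others in B' are edges, and this remains true
    for the k-sets extending any fixed vertex or any fixed good set.

    Every vertex v outside B' lies in an l-path with s (or s - 1) edges, all
    containing v, whose other vertices are in B' and whose ends are linkable: the
    part of the link of v that avoids bad sets is dense, hence contains a tight
    path.  Such paths cover V_0, the P_i make up for the vertices of A in B', and
    using s - 1 edges for some vertices of A' corrects the number of edges.  Add
    bare linkable l-tuples until the leftover vertices are exactly those needed
    to join the pieces cyclically by connectors of 3 s edges, each edge with one
    vertex of A'.

    The connectors are found by an exchange argument in the spirit of Daykin and
    Haggkvist.  Distribute the leftover vertices arbitrarily.  If some connector is
    bad, spread its vertices over the middle columns of randomly chosen other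
    connectors and permute the remaining entries so that each new connector takes
    its entries from distinct old ones.  An edge meeting an end of a connector then
    has only random free entries, and an edge through the middle column has just
    one prescribed entry, so a union bound gives a choice for which all the
    connectors involved become good. *)

(** * Paths given by vertex sequences *)

(** Distinctness of the vertices is kept apart, and a sequence shorter than [k] qualifies vacuously,
    so bare [l]-tuples count as paths without edges. *)
Definition window_path (V : finType) (k d : nat) (E : {set {set V}})
    (p : seq V) : Prop :=
  forall i : nat, i * d + k <= size p ->
    [set x in take k (drop (i * d) p)] \in E.

(** A window that starts inside [p] starts at least [d] before its end and so stops within [u],
    whose size is [k - d]. Any other window lies in [u ++ r], with aligned positions because [d]
    divides [size p]. *)
Lemma window_path_glue (V : finType) (k d : nat) (E : {set {set V}})
    (p u r : seq V) :
  d %| size p -> size u + d = k ->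
  window_path k d E (p ++ u) -> window_path k d E (u ++ r) ->
  window_path k d E (p ++ u ++ r).
Proof.
move=> /dvdnP[m sp] su wp wr i hi.
have [him|him] := ltnP i m.
  have hs : i * d + k <= size (p ++ u).
    rewrite size_cat sp; have : i.+1 * d <= m * d by rewrite leq_mul2r him orbT.
    rewrite mulSn; lia.
  have := wp i hs; rewrite catA (drop_cat (i * d) (p ++ u)).
  case: ltnP => h1 h; first by rewrite takel_cat // size_drop; lia.
  have k0 : k = 0 by lia.
  by move: h; rewrite k0 !take0.
have hmd : m * d <= i * d by rewrite leq_mul2r him orbT.
have {}hi : (i - m) * d + k <= size (u ++ r).
  by move: hi; rewrite !size_cat sp mulnBl; lia.
have := wr _ hi; rewrite (drop_cat (i * d) p).
by rewrite sp ltnNge hmd /= mulnBl.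
Qed.

Lemma window_path_chain (V : finType) (k l d : nat) (E : {set {set V}})
    (b : nat -> seq V) :
  l + d = k -> (forall j, d %| size (b j)) -> (forall j, l <= size (b j)) ->
  (forall j, window_path k d E (b j ++ take l (b j.+1))) ->
  forall m, window_path k d E (flatten [seq b j | j <- iota 0 m.+1] ++ take l (b m.+1)).
Proof.
move=> lk db lb wb; elim=> [|m IH]; first by rewrite /= cats0.
have -> : iota 0 m.+2 = rcons (iota 0 m.+1) m.+1 by rewrite -[in LHS]addn1 iotaD cats1.
rewrite map_rcons flatten_rcons -catA.
rewrite -[in X in window_path _ _ _ (_ ++ X)](cat_take_drop l (b m.+1)) -catA.
apply: window_path_glue => //.
- move: (iota 0 m.+1) => t; elim: t {IH} => [|x t IHt] /=; first by rewrite dvdn0.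
  by rewrite size_cat dvdn_add.
- by rewrite size_takel // lb.
- by rewrite catA cat_take_drop.
Qed.

(** A window of the cycle starts at least [d] before the end of [c], so it wraps around by at most
    [k - d = l] entries, which [take l c] supplies. *)
Lemma window_path_cycle (V : finType) (k l d : nat) (E : {set {set V}})
    (c : seq V) :
  l + d = k -> d %| size c -> k <= size c ->
  window_path k d E (c ++ take l c) ->
  forall i, i < size c %/ d -> [set x in take k (rot (i * d) c)] \in E.
Proof.
move=> lk /dvdnP[m sc] kc w i hi.
have d0 : 0 < d by case: d hi {lk sc w} => //; rewrite divn0.
have him : i < m by move: hi; rewrite sc mulnK.
have hid : i * d + d <= size c by rewrite sc -mulSnr leq_mul2r him orbT.
have := w i; rewrite size_cat size_takel; last by lia.
move=> /(_ ltac:(lia)); congr (_ \in E); apply/setP=> x; rewrite !inE.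
congr (x \in _); rewrite /rot drop_cat.
rewrite (_ : i * d < size c); last lia.
rewrite !take_cat size_drop; case: ltnP => // h.
congr (_ ++ _).
rewrite take_takel; last by lia.
by rewrite take_takel; last by lia.
Qed.

(** * Tight paths in dense set families *)

Definition shadow (V : finType) (r : nat) (G : {set {set V}}) : {set {set V}} :=
  [set S : {set V} | (#|S| == r) && [exists x, (x \notin S) && (x |: S \in G)]].

(* A subfamily maximising |G| - T |shadow G| has no shadow set of degree < T:
   deleting all its members above such a set would increase the difference. *)
Lemma dense_shadow_subfamily (V : finType) (r T : nat) (U : {set V})
    (F : {set {set V}}) :
  (forall W, W \in F -> (#|W| = r.+1) /\ W \subset U) ->
  T * 'C(#|U|, r) < #|F| ->
  exists G : {set {set V}}, [/\ G \subset F, G != set0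
    & forall S, S \in shadow r G ->
        T <= #|[set x | (x \notin S) && (x |: S \in G)]|].
Proof.
move=> FU hF.
have shC (G : {set {set V}}) : G \subset F -> #|shadow r G| <= 'C(#|U|, r).
  move=> /subsetP GF; rewrite -cards_draws; apply: subset_leq_card.
  apply/subsetP=> S; rewrite !inE => /andP[-> /existsP[x /andP[_ /GF /FU [_ h]]]].
  by rewrite andbT; apply: subset_trans h; apply: subsetUr.
(* The constant [T * 'C(#|U|, r)] bounds [T * #|shadow r G|], so the subtraction of natural numbers
   never truncates. *)
pose val (G : {set {set V}}) := #|G| + T * 'C(#|U|, r) - T * #|shadow r G|.
case: (@arg_maxnP _ F (fun G => G \subset F) val (subxx F)) => G GF Gmax.
have hG : T * #|shadow r G| < #|G|.
  have := Gmax F (subxx F); rewrite /val.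
  have := leq_mul (leqnn T) (shC F (subxx _)).
  have := leq_mul (leqnn T) (shC G GF); lia.
exists G; split=> // [|S hS].
  by rewrite -card_gt0; apply: leq_ltn_trans hG.
rewrite leqNgt; apply/negP => hlt.
pose G' := [set W in G | ~~ (S \subset W)].
have G'F : G' \subset F.
  by apply: subset_trans GF; apply/subsetP=> W; rewrite inE => /andP[].
have hsh : #|shadow r G'| < #|shadow r G|.
  rewrite (cardsD1 S (shadow r G)) hS ltnS; apply: subset_leq_card.
  apply/subsetP=> S'; rewrite !inE => /andP[-> /existsP[x /andP[xS' ]]].
  rewrite inE => /andP[h1 h2]; apply/andP; split; last first.
    by apply/existsP; exists x; rewrite xS' h1.
  by apply: contraNneq h2 => ->; apply: subsetUr.
have sS : #|S| = r by move: hS; rewrite inE => /andP[/eqP].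
have hc : #|G| <= #|G'| + #|[set x | (x \notin S) && (x |: S \in G)]|.
  rewrite -(cardsID [set W : {set V} | ~~ (S \subset W)] G) leq_add //.
    by apply: subset_leq_card; apply/subsetP=> W; rewrite !inE.
  apply: leq_trans (leq_imset_card (fun x => x |: S) _).
  apply: subset_leq_card; apply/subsetP=> W; rewrite !inE negbK => /andP[SW WG].
  have [cW _] := FU W (subsetP GF W WG).
  have /card_gt0P[x] : 0 < #|W :\: S|.
    by rewrite cardsD (setIidPr SW) cW sS; lia.
  rewrite inE => /andP[xS xW].
  have e : x |: S = W.
    apply/eqP; rewrite eqEcard subUset sub1set xW SW /=.
    by rewrite cardsU1 xS cW sS.
  by apply/imsetP; exists x; rewrite // inE xS e.
have := Gmax G' G'F; rewrite /val.
have := leq_mul (leqnn T) (shC G GF).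
have := leq_mul (leqnn T) (shC G' G'F).
have := leq_mul (leqnn T) hsh; rewrite mulnS.
case: T hlt hc {hF val Gmax hG} => // T; lia.
Qed.

(** In the subfamily of [dense_shadow_subfamily] the last [r] vertices of a path always form a
    shadow set with at least [T] extensions, and a path of fewer than [T] vertices cannot contain
    all of them. *)
Lemma tight_path (V : finType) (r T : nat) (U : {set V}) (F : {set {set V}}) :
  (forall W, W \in F -> #|W| = r.+1 /\ W \subset U) ->
  r < T -> T * 'C(#|U|, r) < #|F| ->
  exists z : seq V, [/\ uniq z, size z = T
    & forall i, i + r < T -> [set x in take r.+1 (drop i z)] \in F].
Proof.
move=> FU rT /(dense_shadow_subfamily FU)[G [GF G0 Gdeg]].
suff H m : r + m < T -> exists z : seq V, [/\ uniq z, size z = (r + m).+1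
    & forall i, i <= m -> [set x in take r.+1 (drop i z)] \in G].
  have [] := H (T - r.+1); first by lia.
  move=> z [uz sz wz]; exists z; split=> //; first by lia.
  by move=> i hi; apply: (subsetP GF); apply: wz; lia.
elim: m => [_|m IH hm].
  have [W WG] := set0Pn _ G0; have [cW _] := FU W (subsetP GF W WG).
  exists (enum W); rewrite enum_uniq -cardE cW addn0; split=> // i.
  rewrite leqn0 => /eqP->; rewrite drop0 take_oversize -?cardE ?cW //.
  by rewrite (_ : [set x in enum W] = W) //; apply/setP=> x; rewrite inE mem_enum.
have [|z [uz sz wz]] := IH; first by lia.
pose S := [set x in drop m.+1 z].
have sd : size (drop m.+1 z) = r by rewrite size_drop sz; lia.
have cS : #|S| = r by rewrite cardsE (card_uniqP _) ?drop_uniq.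
have hS : S \in shadow r G.
  rewrite inE cS eqxx /=.
  have := wz m (leqnn _); rewrite take_oversize; last by rewrite size_drop sz; lia.
  have zm : m < size z by rewrite sz; lia.
  case: z uz sz {wz} @S sd cS zm => // x0 z' uz sz S sd cS zm.
  rewrite (drop_nth x0 zm) => h; apply/existsP; exists (nth x0 (x0 :: z') m).
  rewrite inE (_ : _ |: S = [set x in nth x0 (x0 :: z') m :: drop m.+1 (x0 :: z')]).
    rewrite h andbT; have := drop_uniq m uz.
    by rewrite (drop_nth x0 zm) cons_uniq => /andP[].
  by apply/setP=> x; rewrite !inE.
have hd := Gdeg S hS.
have [x xN xz] : exists2 x, x \in [set x | (x \notin S) && (x |: S \in G)] & x \notin z.
  apply/exists_inP; apply: contraT; rewrite negb_exists_in => /forall_inP h.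
  have : #|[set x | (x \notin S) && (x |: S \in G)]| <= #|[set x in z] :\: S|.
    apply: subset_leq_card; apply/subsetP=> x hx.
    by rewrite !inE -(negbK (x \in z)) h // andbT; move: hx; rewrite !inE => /andP[].
  have cz : #|[set x in z]| = size z by rewrite cardsE; apply/card_uniqP.
  have SZ : S \subset [set x in z].
    by apply/subsetP=> y; rewrite !inE; apply: mem_drop.
  have := cardsD [set x in z] S; rewrite (setIidPr SZ) cz sz cS; lia.
exists (rcons z x); split.
- by rewrite rcons_uniq xz.
- by rewrite size_rcons sz addnS.
move=> i; rewrite leq_eqVlt => /orP[/eqP->|]; last first.
  rewrite ltnS => him; have := wz i him; congr (_ \in G); apply/setP=> y; rewrite !inE.
  rewrite drop_rcons ?sz; last by lia.
  by rewrite -cats1 takel_cat // size_drop sz; lia.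
rewrite drop_rcons ?sz; last by lia.
rewrite take_oversize ?size_rcons ?sd //.
move: xN; rewrite !inE => /andP[_]; congr (_ \in G).
by apply/setP=> y; rewrite !inE mem_rcons !inE.
Qed.

(** * Redistribution of assignments *)

Lemma card_family_prod (I T : finType) (F : I -> {pred T}) :
  #|[set f : {ffun I -> T} | [forall i, f i \in F i]]| = \prod_i #|F i|.
Proof.
rewrite (_ : #|_| = #|family F|); last first.
  by apply: eq_card => f; rewrite inE; apply/forallP/familyP.
rewrite card_family [RHS](_ : _ = \prod_(i <- enum I) #|F i|); last first.
  by rewrite big_enum.
rewrite /image_mem; elim: (enum I) => [|i s IH]; first by rewrite big_nil.
by rewrite big_cons -IH.
Qed.

Lemma card_ffun_fixed (I T : finType) (D : {set I}) (g : I -> T) :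
  #|[set f : {ffun I -> T} | [forall i in D, f i == g i]]| = #|T| ^ #|~: D|.
Proof.
pose F i : {pred T} := if i \in D then pred1 (g i) else predT.
transitivity #|[set f : {ffun I -> T} | [forall i, f i \in F i]]|.
  apply: eq_card => f; rewrite !inE; apply: eq_forallb => i.
  by rewrite /F; case: (i \in D).
rewrite card_family_prod (bigID (mem D)) /= big1 ?mul1n; last first.
  by move=> i iD; rewrite /F iD card1.
rewrite -prod_nat_const big_mkcond [RHS]big_mkcond.
by apply: eq_bigr => i _; rewrite /F inE; case: (i \in D).
Qed.

Lemma leq_card_bigcup (I T : finType) (P : pred I) (F : I -> {set T}) :
  #|\bigcup_(i | P i) F i| <= \sum_(i | P i) #|F i|.
Proof.
elim/big_rec2: _ => [|i m A _ IH]; first by rewrite cards0.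
by rewrite (leq_trans _ (leq_add (leqnn _) IH)) // cardsU leq_subr.
Qed.

Section Reshuffle.

(** [J] indexes the connectors and ['I_K] their columns. A column with [xc] is filled from [X], the
    others from [Y], and [mid b] is a middle column of type [b]. *)
Variables (V J : finType) (K : nat) (xc : pred 'I_K) (mid : bool -> 'I_K).
Variables (X Y : {set V}) (good : J -> {ffun 'I_K -> V} -> bool) (beta : nat).

Definition typed (z : {ffun 'I_K -> V}) : bool :=
  [forall c, z c \in if xc c then X else Y].

Hypothesis xc_mid : forall b, xc (mid b) = b.
Hypothesis few_bad : forall j b u, u \in (if b then X else Y) ->
  #|[set z : {ffun 'I_K -> V} |
      [&& typed z, injectiveb z, z (mid b) == u & ~~ good j z]]| <= beta.
(** The right side counts the choices of [K] further rows. The summands on the left bound the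
    choices that make one of the [K.+1] new rows bad, and those that repeat a row. *)
Hypothesis large : K.+1 * (#|J| * beta) + K.+1 * K.+1 * #|J| ^ K.-1 < #|J| ^ K.

Definition arrangement (a : J -> {ffun 'I_K -> V}) : Prop :=
  injective (fun p : J * 'I_K => a p.1 p.2) /\ forall j, typed (a j).

Section Step.

Variables (a : J -> {ffun 'I_K -> V}) (j0 : J).
Hypothesis arr_a : arrangement a.

(* The rows 0, ..., K are the bad assignment and K random other ones.  Column c is
   shifted cyclically by c + 1 rows, so each new row has its entries from
   distinct old rows; sigma r then moves the entry of row r that comes from the
   bad assignment to a middle column. *)
Let sigma (r : 'I_K.+1) : {perm 'I_K} :=
  if unlift ord0 (- r)%R is Some c then tperm c (mid (xc c)) else 1%g.

Let row (tau : {ffun 'I_K.+1 -> J}) (r : 'I_K.+1) : {ffun 'I_K -> V} :=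
  [ffun c => a (tau (r + lift ord0 (sigma r c))%R) (sigma r c)].

Let new (tau : {ffun 'I_K.+1 -> J}) (j : J) : {ffun 'I_K -> V} :=
  if [pick r | tau r == j] is Some r then row tau r else a j.

Let xc_sigma r c : xc (sigma r c) = xc c.
Proof.
rewrite /sigma; case: unlift => [c'|]; last by rewrite perm1.
by case: tpermP => [->|->|_ _] //; rewrite xc_mid.
Qed.

Let typed_row tau r : typed (row tau r).
Proof.
apply/forallP => c; rewrite ffunE -(xc_sigma r c).
by have [_ /(_ (tau (r + lift ord0 (sigma r c))%R)) /forallP] := arr_a.
Qed.

(** Equal entries of [a] have the same old row and column. The column determines the shift, hence
    [r], and then [c]. *)
Let row_inj (tau : {ffun 'I_K.+1 -> J}) r c r' c' : injective tau -> row tau r c = row tau r' c' ->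
  r = r' /\ c = c'.
Proof.
move=> it; rewrite !ffunE => h; have [ia _] := arr_a.
have [/it e1 e2] := ia (_, _) (_, _) h.
move: e1; rewrite e2 => /GRing.addIr e; split=> //.
by move: e2; rewrite e => /perm_inj.
Qed.

Let new_arr (tau : {ffun 'I_K.+1 -> J}) : injective tau -> arrangement (new tau).
Proof.
move=> it; have [ia ta] := arr_a; split; last first.
  by move=> j; rewrite /new; case: pickP => [r _|_] //; apply: typed_row.
have mixed j c r c' : (forall r, (tau r == j) = false) -> a j c <> row tau r c'.
  move=> h; rewrite ffunE => e; have [e' _] := ia (_, _) (_, _) e.
  by have := h (r + lift ord0 (sigma r c'))%R; rewrite -e' eqxx.
move=> [j c] [j' c'] /=; rewrite /new.
case: pickP => [r /eqP hr|hn]; case: pickP => [r' /eqP hr'|hn'] h.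
- by have [e1 e2] := row_inj it h; rewrite -hr -hr' e1 e2.
- by case: (mixed _ _ _ _ hn' (esym h)).
- by case: (mixed _ _ _ _ hn h).
- exact: (ia (_, _) (_, _) h).
Qed.

Let row_injective (tau : {ffun 'I_K.+1 -> J}) r : injective tau -> injectiveb (row tau r).
Proof. by move=> it; apply/injectiveP => c c' h; have [] := row_inj it h. Qed.

(* Every row other than the first receives exactly one entry of the bad
   assignment a j0, and it sits in the middle column of its colour. *)
Let row_mid (tau : {ffun 'I_K.+1 -> J}) r c : tau ord0 = j0 -> unlift ord0 (- r)%R = Some c ->
  row tau r (mid (xc c)) = a j0 c.
Proof.
move=> t0 e; rewrite ffunE /sigma e tpermR.
have -> : (r + lift ord0 c)%R = ord0.
  have -> : lift ord0 c = (- r)%R by case: unliftP e => // c' -> [->].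
  by rewrite GRing.addrN; apply/val_inj.
by rewrite t0.
Qed.

(** For every [r'] other than [r], the new row [r] receives an entry of the old row [tau r'], in the
    column with shift [r' - r]. Since all entries of [a] are distinct, this entry identifies
    [tau r']. *)
Let rows_determine (tau tau' : {ffun 'I_K.+1 -> J}) r :
  tau r = tau' r -> row tau r = row tau' r -> tau = tau'.
Proof.
move=> er erow; apply/ffunP => r'.
case: (unliftP ord0 (r' - r)%R) => [c hc|h0]; last first.
  have -> : r' = r; last by [].
  by apply/eqP; rewrite -GRing.subr_eq0 h0; apply/eqP/val_inj.
have := congr1 (fun f : {ffun 'I_K -> V} => f ((sigma r)^-1%g c)) erow.
rewrite !ffunE permKV -hc GRing.addrC GRing.subrK => h.
by have [ia _] := arr_a; have [] := ia (_, _) (_, _) h.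
Qed.

Let T0 : {set {ffun 'I_K.+1 -> J}} := [set tau : {ffun 'I_K.+1 -> J} | tau ord0 == j0].

Let card_T0 : #|T0| = #|J| ^ K.
Proof.
have := card_ffun_fixed [set (ord0 : 'I_K.+1)] (fun _ => j0).
rewrite cardsC1 card_ord /= => <-; apply: eq_card => f.
by rewrite !inE; apply/idP/forall_inP => [/eqP h i|/(_ ord0)]; rewrite inE ?eqxx //;
   [move=> /eqP->; apply/eqP | apply].
Qed.

(** On colliding choices the value at [r'] can be read off at [r], so overwriting it by [j0] is
    injective and leaves [K.-1] free values. *)
Let card_collide r r' : r' != ord0 -> r != r' ->
  #|[set tau in T0 | tau r == tau r']| <= #|J| ^ K.-1.
Proof.
move=> r'0 rr'.
pose forget (tau : {ffun 'I_K.+1 -> J}) : {ffun 'I_K.+1 -> J} :=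
  [ffun i => if i == r' then j0 else tau i].
have forget_inj : {in [set tau in T0 | tau r == tau r'] &, injective forget}.
  move=> f g; rewrite !inE => /andP[_ /eqP hf] /andP[_ /eqP hg] h.
  apply/ffunP=> i; have hi := congr1 (fun f : {ffun _ -> _} => f i) h.
  move: hi; rewrite !ffunE; case: eqP => [-> _|//].
  have := congr1 (fun f : {ffun _ -> _} => f r) h; rewrite !ffunE (negbTE rr').
  by rewrite hf hg.
rewrite -(card_in_imset forget_inj).
have := card_ffun_fixed [set (ord0 : 'I_K.+1); r'] (fun _ => j0).
have -> : #|~: [set (ord0 : 'I_K.+1); r']| = K.-1.
  by rewrite cardsCs setCK cards2 eq_sym r'0 card_ord subSS subn1.
move=> <-; apply: subset_leq_card; apply/subsetP => _ /imsetP[tau ht ->].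
move: ht; rewrite !inE => /andP[/eqP t0 _]; apply/forall_inP => i.
by rewrite !inE ffunE; case: (i == r') => //; case: eqP => // ->; rewrite t0.
Qed.

Let noninj : {set {ffun 'I_K.+1 -> J}} := [set tau : {ffun 'I_K.+1 -> J} in T0 | ~~ injectiveb tau].

Let card_noninj : #|noninj| <= K.+1 * K.+1 * #|J| ^ K.-1.
Proof.
have sub : noninj \subset \bigcup_(p : 'I_K.+1 * 'I_K.+1 | (p.2 != ord0) && (p.1 != p.2))
    [set tau in T0 | tau p.1 == tau p.2].
  apply/subsetP => tau; rewrite inE => /andP[tT /injectivePn[r [r' rr' e]]].
  apply/bigcupP; have [r0|r0] := eqVneq r' ord0.
    exists (r', r); first by rewrite /= -r0 rr' eq_sym rr'.
    by rewrite inE tT e eqxx.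
  by exists (r, r'); rewrite /= ?r0 ?rr' // inE tT e eqxx.
apply: leq_trans (subset_leq_card sub) _.
apply: leq_trans (leq_card_bigcup _ _) _.
apply: (@leq_trans (\sum_(p : 'I_K.+1 * 'I_K.+1) #|J| ^ K.-1)).
  rewrite big_mkcond; apply: leq_sum => p _; case: ifP => // /andP[].
  exact: card_collide.
by rewrite sum_nat_const card_prod !card_ord.
Qed.

Let bad_row r : {set {ffun 'I_K.+1 -> J}} :=
  [set tau in T0 | injectiveb tau && ~~ good (tau r) (row tau r)].

Let bad_at j b u : {set {ffun 'I_K -> V}} :=
  [set z | [&& typed z, injectiveb z, z (mid b) == u & ~~ good j z]].

(** For [r] other than [ord0] a middle column of the new row holds a fixed vertex of the bad
    assignment, so [few_bad] counts the bad rows for each value of [tau r]. Row [ord0] has no such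
    entry, but its target [j0] is fixed; there the sum runs over the old row that supplies a middle
    column. Either way the index and the row determine [tau]. *)
Let card_bad_row r : #|bad_row r| <= #|J| * beta.
Proof.
have typed_a j c : a j c \in if xc c then X else Y.
  by have [_ /(_ j) /forallP] := arr_a.
have bound (f : J -> {set {ffun 'I_K -> V}}) (h : {ffun 'I_K.+1 -> J} -> J) :
    (forall j, #|f j| <= beta) ->
    (forall tau, tau \in bad_row r -> row tau r \in f (h tau)) ->
    {in bad_row r &, injective (fun tau => (h tau, row tau r))} ->
    #|bad_row r| <= #|J| * beta.
  move=> fb hin hinj; rewrite -(card_in_imset hinj).
  apply: (@leq_trans #|\bigcup_j [set (j, z) | z in f j]|).
    apply: subset_leq_card; apply/subsetP => _ /imsetP[tau ht ->].
    by apply/bigcupP; exists (h tau) => //; apply: imset_f; apply: hin.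
  apply: leq_trans (leq_card_bigcup _ _) _.
  rewrite -sum_nat_const; apply: leq_sum => j _.
  by apply: leq_trans (leq_imset_card _ _) (fb j).
case e : (unlift ord0 (- r)%R) => [c|].
  apply: (bound (fun j => bad_at j (xc c) (a j0 c)) (fun tau => tau r)).
  - by move=> j; apply: few_bad.
  - move=> tau; rewrite !inE => /andP[/eqP t0 /andP[it ->]].
    by rewrite typed_row (row_injective r (injectiveP _ it)) (row_mid t0 e) eqxx.
  - by move=> t t' _ _ [h1 h2]; apply: rows_determine h1 h2.
have r0 : r = ord0.
  case: unliftP e => // e _; apply/eqP; rewrite -GRing.oppr_eq0 e.
  by apply/eqP/val_inj.
apply: (bound (fun j => bad_at j0 true (a j (mid true)))
  (fun tau => tau (r + lift ord0 (mid true))%R)).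
- by move=> j; apply: few_bad; have := typed_a j (mid true); rewrite xc_mid.
- move=> tau; rewrite !inE => /andP[/eqP t0 /andP[it]].
  rewrite (_ : tau r = j0) => [->|]; last by rewrite r0.
  rewrite typed_row (row_injective _ (injectiveP _ it)) /= andbT ffunE.
  by rewrite /sigma e perm1 eqxx.
- move=> t t'; rewrite !inE => /andP[/eqP t0 _] /andP[/eqP t0' _] [_ h].
  by apply: rows_determine h; rewrite r0 t0 t0'.
Qed.

(** By the union bound some injective [tau] in [T0] has only good new rows. Rows outside its range
    are unchanged, so no good row becomes bad, while [j0] becomes good. *)
Lemma reshuffle_step : exists b, [/\ arrangement b, good j0 (b j0)
  & forall j, good j (a j) -> good j (b j)].
Proof.
pose bads := noninj :|: \bigcup_r bad_row r.
have : #|bads| < #|T0|.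
  rewrite card_T0; apply: leq_ltn_trans large.
  rewrite cardsU; apply: leq_trans (leq_subr _ _) _; rewrite addnC.
  apply: leq_add; last exact: card_noninj.
  apply: leq_trans (leq_card_bigcup _ _) _.
  rewrite -[K.+1 in leqRHS]card_ord -sum_nat_const; apply: leq_sum => r _.
  exact: card_bad_row.
rewrite ltnNge; case: (boolP (T0 \subset bads)) => [/subset_leq_card->//|].
case/subsetPn => tau tT; rewrite inE negb_or => /andP[tn tb] _.
have it : injective tau.
  by apply/injectiveP; move: tn; rewrite inE tT negbK.
have good_row r : good (tau r) (row tau r).
  apply: contraNT tb => h; apply/bigcupP; exists r => //.
  by rewrite inE tT h andbT; apply/injectiveP.
have good_new r : good (tau r) (new tau (tau r)).
  rewrite /new; case: pickP => [r' /eqP /it ->|/(_ r)]; first exact: good_row.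
  by rewrite eqxx.
exists (new tau); split; first exact: new_arr.
  by move: (good_new ord0); have /eqP -> : tau ord0 == j0 by rewrite inE in tT.
move=> j gj; rewrite /new; case: pickP => [r /eqP <-|//]; exact: good_row.
Qed.

End Step.

Theorem reshuffle (a : J -> {ffun 'I_K -> V}) : arrangement a ->
  exists b, arrangement b /\ forall j, good j (b j).
Proof.
have [m] := ubnP #|[set j | ~~ good j (a j)]|.
elim: m a => // m IH a hm arr.
case: (pickP [pred j | ~~ good j (a j)]) => [j0 /= hj0|h]; last first.
  by exists a; split=> // j; have /negbFE := h j.
have [b [arrb gj0 gj]] := reshuffle_step j0 arr.
apply: (IH b) => //; rewrite ltnS in hm; apply: leq_trans hm.
apply: proper_card; apply/properP; split.
  by apply/subsetP => j; rewrite !inE; apply: contra; apply: gj.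
by exists j0; rewrite !inE ?gj0.
Qed.

End Reshuffle.

(** Once the image of [D] is chosen in [F], each column of [D] has at most [#|D|] values, column [m]
    has one and the others are free. *)
Lemma count_prescribed_image (I V : finType) (D : {set I}) (m : I) (u : V)
    (F : {set {set V}}) :
  m \notin D -> (forall W, W \in F -> #|W| = #|D|) ->
  #|[set z : {ffun I -> V} | (z @: D \in F) && (z m == u)]|
    <= #|F| * (#|D| ^ #|D| * #|V| ^ (#|I| - 1 - #|D|)).
Proof.
move=> mD cF.
pose P (W : {set V}) i : {pred V} :=
  if i \in D then [pred x in W] else if i == m then pred1 u else predT.
pose G W := [set z : {ffun I -> V} | [forall i, z i \in P W i]].
apply: (@leq_trans #|\bigcup_(W in F) G W|).
  apply: subset_leq_card; apply/subsetP => z; rewrite inE => /andP[zF /eqP zm].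
  apply/bigcupP; exists (z @: D) => //; rewrite inE; apply/forallP => i.
  rewrite /P; case: ifP => [iD|_]; first exact: imset_f.
  by case: eqP => // ->; rewrite inE zm.
apply: leq_trans (leq_card_bigcup _ _) _.
rewrite -sum_nat_const; apply: leq_sum => W WF.
rewrite card_family_prod (bigID (mem D)) /=.
have -> : \prod_(i in D) #|P W i| = #|D| ^ #|D|.
  by rewrite -prod_nat_const; apply: eq_bigr => i iD; rewrite /P iD cF.
rewrite leq_mul2l; apply/orP; right.
rewrite (bigD1 m) //= /P (negbTE mD) eqxx card1 mul1n.
rewrite (eq_bigr (fun=> #|V|)); last first.
  by move=> i /andP[/negbTE -> /negbTE ->].
rewrite prod_nat_const (_ : #|_| = #|I| - 1 - #|D|) //.
rewrite (_ : #|_| = #|~: (m |: D)|); last first.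
  by apply: eq_card => i; rewrite !inE negb_or andbC.
by have := cardsC (m |: D); rewrite cardsU1 mD /= => <-; lia.
Qed.

(** Truncated subtraction removes the case distinction of [drop_cat]. *)
Lemma drop_cat_sub (T : Type) (a : nat) (p q : seq T) :
  drop a (p ++ q) = drop a p ++ drop (a - size p) q.
Proof.
rewrite drop_cat; case: ltnP => [h|h]; last by rewrite [drop a p]drop_oversize.
by rewrite (_ : a - size p = 0) ?drop0 //; lia.
Qed.

Lemma take_cat_sub (T : Type) (a : nat) (p q : seq T) :
  take a (p ++ q) = take a p ++ take (a - size p) q.
Proof.
rewrite take_cat; case: ltnP => [h|h]; last by rewrite [take a p]take_oversize.
by rewrite (_ : a - size p = 0) ?take0 ?cats0 //; lia.
Qed.

Definition columns (K a b : nat) : {set 'I_K} := [set c : 'I_K | a <= c < b].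

Lemma slice_codom (V : finType) (K a b : nat) (z : {ffun 'I_K -> V}) :
  [set x in take b (drop a (codom z))] = z @: columns K a (a + b).
Proof.
apply/setP => x; rewrite inE /codom /image_mem -map_drop -map_take.
have mem c : (c \in take b (drop a (enum 'I_K))) = (c \in columns K a (a + b)).
  rewrite !inE -(mem_map val_inj) map_take map_drop val_enum_ord.
  rewrite drop_iota take_iota mem_iota add0n.
  by have := ltn_ord c; rewrite /=; lia.
apply/mapP/imsetP => [[c hc ->]|[c hc ->]]; exists c => //.
  by rewrite -mem.
by rewrite mem.
Qed.

Lemma card_columns (K a b : nat) : b <= K -> #|columns K a b| = b - a.
Proof.
move=> bK; suff -> : #|columns K a b| = minn b K - a by rewrite (minn_idPl bK).
rewrite -sum1_card (eq_bigl (fun c : 'I_K => a <= c < b)); last first.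
  by move=> c; rewrite inE.
rewrite -(big_mkord (fun c => a <= c < b) (fun=> 1)).
elim: K {bK} => [|K IH]; first by rewrite big_nil minn0 sub0n.
rewrite big_mkcond big_nat_recr //= -big_mkcond IH.
by case: ifP; lia.
Qed.

(** * Connectors *)

(** The last inequalities say that [s] is [k / d] rounded up and that [d] does not divide [k]. *)
Definition path_params (k l s d : nat) : Prop :=
  [/\ 2 <= d, 2 <= s, 2 <= l, k = l + d & k < s * d < k + d].

Section Columns.

Variables (V : finType) (k l s d : nat) (E : {set {set V}}).
Hypothesis par : path_params k l s d.
Let d_ge2 : 2 <= d. Proof. by case: par. Qed.
Let s_ge2 : 2 <= s. Proof. by case: par. Qed.
Let l_ge2 : 2 <= l. Proof. by case: par. Qed.
Let def_k : k = l + d. Proof. by case: par. Qed.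
Let k_lt_sd : k < s * d. Proof. by case: par => _ _ _ _ /andP[]. Qed.
Let sd_lt_kd : s * d < k + d. Proof. by case: par => _ _ _ _ /andP[]. Qed.

(* A connector is placed after an end of l vertices, so column c has position
   c + l; the three vertices of A' are s d apart, at positions i s d - d. *)
Definition conn_size : nat := 3 * (s * d) - l.
Let K := conn_size.

Definition is_xcol : pred 'I_K := fun c =>
  [|| c + l == s * d - d, c + l == 2 * (s * d) - d | c + l == 3 * (s * d) - d].

Lemma mid_proof (b : bool) : 2 * (s * d) - d + ~~ b - l < K.
Proof. by rewrite /K /conn_size; case: b => /=; lia. Qed.

(* The two columns lie in no window that meets one of the two ends. *)
Definition mid_col (b : bool) : 'I_K := Ordinal (mid_proof b).

Lemma is_xcol_mid b : is_xcol (mid_col b) = b.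
Proof. by rewrite /is_xcol /mid_col /=; case: b => /=; lia. Qed.

Lemma conn_sizeE : K + l = 3 * (s * d).
Proof. by rewrite /K /conn_size; lia. Qed.

Lemma card_xcol : #|[set x | is_xcol (x : 'I_K)]| = 3.
Proof.
have p v : v < 3 -> v.+1 * (s * d) - d - l < K.
  move=> v3; have h : v.+1 * (s * d) <= 3 * (s * d) by rewrite leq_mul2r v3 orbT.
  by rewrite /K /conn_size; lia.
pose f (v : 'I_3) : 'I_K := Ordinal (p v (ltn_ord v)).
have fi : injective f.
  move=> v w /(congr1 val) /= h; apply/val_inj => /=.
  have hv : s * d <= v.+1 * (s * d) by rewrite leq_pmull.
  have hw : s * d <= w.+1 * (s * d) by rewrite leq_pmull.
  have : v.+1 * (s * d) == w.+1 * (s * d) by apply/eqP; lia.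
  by rewrite eqn_pmul2r; [move=> /eqP[]|lia].
rewrite -[3]card_ord -cardsT -(card_imset _ fi); apply: eq_card => x.
rewrite inE; apply/idP/imsetP => [|[v _ ->]]; last first.
  by case: v => [[|[|[|a]]] ha] //; rewrite /is_xcol /=; lia.
rewrite /is_xcol => /or3P[] h.
- by exists (inord 0); rewrite ?inE //; apply/val_inj; rewrite /= inordK //; lia.
- by exists (inord 1); rewrite ?inE //; apply/val_inj; rewrite /= inordK //; lia.
- by exists (inord 2); rewrite ?inE //; apply/val_inj; rewrite /= inordK //; lia.
Qed.

(** Together with its two ends a connector has [l + 3 * (s * d)] vertices, hence [3 * s] edges. *)
Definition connects (lend rend : seq V) (z : {ffun 'I_K -> V}) : bool :=
  [forall i : 'I_(3 * s),
     [set x in take k (drop (i * d) (lend ++ codom z ++ rend))] \in E].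

Lemma connectsP lend rend (z : {ffun 'I_K -> V}) :
  size lend = l -> size rend = l -> connects lend rend z ->
  window_path k d E (lend ++ codom z ++ rend).
Proof.
move=> sl sr /forallP h i.
rewrite !size_cat size_codom card_ord sl sr => hi.
have hi3 : i < 3 * s.
  rewrite -(ltn_pmul2r (_ : 0 < d)); last by lia.
  by move: hi; rewrite /K /conn_size -mulnA; lia.
exact: (h (Ordinal hi3)).
Qed.

Lemma connector_window lend rend (z : {ffun 'I_K -> V}) a :
  size lend = l -> size rend = l -> a <= 3 * (s * d) - d ->
  [set x in take k (drop a (lend ++ codom z ++ rend))] =
  ([set x in drop a lend] :|: [set x in take (a + k - 3 * (s * d)) rend])
    :|: z @: columns K (a - l) (minn (a + k - l) K).
Proof.
move=> sl sr ha; rewrite drop_cat_sub take_cat_sub drop_cat_sub take_cat_sub.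
rewrite !size_drop !size_codom card_ord sl.
rewrite (_ : a - l - K = 0) ?drop0; last by rewrite /K /conn_size; lia.
rewrite [take k _]take_oversize; last by rewrite size_drop; lia.
rewrite (_ : k - (l - a) - (K - (a - l)) = a + k - 3 * (s * d)); last first.
  by rewrite /K /conn_size; lia.
have -> : [set x | x \in drop a lend ++ take (k - (l - a)) (drop (a - l) (codom z)) ++
    take (a + k - 3 * (s * d)) rend] =
  ([set x in drop a lend] :|: [set x in take (a + k - 3 * (s * d)) rend]) :|:
    [set x in take (k - (l - a)) (drop (a - l) (codom z))].
  by apply/setP => x; rewrite !inE !mem_cat orbAC orbA.
rewrite slice_codom.
have -> // : columns K (a - l) (a - l + (k - (l - a))) =
  columns K (a - l) (minn (a + k - l) K).
by apply/setP => c; rewrite !inE; have := ltn_ord c; lia.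
Qed.

End Columns.

Arguments is_xcol {l s d}.

Section Connector.

Variables (V : finType) (k l s d : nat) (E : {set {set V}}).
Hypothesis par : path_params k l s d.
Let d_ge2 : 2 <= d. Proof. by case: par. Qed.
Let s_ge2 : 2 <= s. Proof. by case: par. Qed.
Let l_ge2 : 2 <= l. Proof. by case: par. Qed.
Let def_k : k = l + d. Proof. by case: par. Qed.
Let k_lt_sd : k < s * d. Proof. by case: par => _ _ _ _ /andP[]. Qed.
Let sd_lt_kd : s * d < k + d. Proof. by case: par => _ _ _ _ /andP[]. Qed.

(** [ok] abstracts the good sets, and [Q] is the reciprocal of the permitted proportion of
    non-edges, so that real numbers stay out of the combinatorial part. *)
Variables (Ap Bp : {set V}) (ok : pred {set V}) (Q : nat).
Hypothesis ok0 : ok set0.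
Hypothesis ok1 : forall u, u \in Bp -> ok [set u].
Hypothesis few_nonedges_Ap : forall x, x \in Ap ->
  Q * #|[set W : {set V} | [&& #|W| == k.-1, W \subset Bp & x |: W \notin E]]|
    <= #|V| ^ k.-1.
Hypothesis few_nonedges_ok : forall L : {set V}, ok L -> #|L| <= l ->
  Q * #|[set W : {set V} | [&& #|W| == k - #|L|, [disjoint L & W],
           [exists x in W, (x \in Ap) && (W :\ x \subset Bp)]
         & L :|: W \notin E]]| <= #|V| ^ (k - #|L|).

Let K := conn_size l s d.
Let mid_col := mid_col par.
Let is_xcol_mid := is_xcol_mid par.

Variables (X Y : {set V}).
Hypotheses (XA : X \subset Ap) (YB : Y \subset Bp).

Let N := #|V|.

Let bound r : r <= k -> r < K -> r ^ r * N ^ (K - 1 - r) * N ^ r <= k ^ k * N ^ K.-1.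
Proof.
move=> rk rK; rewrite -mulnA -expnD (_ : K - 1 - r + r = K.-1); last by lia.
rewrite leq_mul2r; apply/orP; right.
have [->|r0] := posnP r; first by rewrite expn_gt0 def_k; lia.
apply: (@leq_trans (r ^ k)); first exact: leq_pexp2l.
by rewrite leq_exp2r //; lia.
Qed.

(** The set of entries of such a window in [D] is counted by [few_nonedges_ok], its entry in column
    [c0] being in [Ap] and the others in [Bp]. Ordering these entries costs at most [k ^ k]; column
    [m] is prescribed and the rest are free. *)
Lemma few_bad_windows (L : {set V}) (D : {set 'I_K}) (m c0 : 'I_K) (u : V) :
  ok L -> #|L| <= l -> #|L| + #|D| = k -> m \notin D ->
  c0 \in D -> is_xcol c0 -> (forall c, c \in D -> c != c0 -> ~~ is_xcol c) ->
  Q * #|[set z : {ffun 'I_K -> V} | [&& typed is_xcol X Y z, injectiveb z,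
           z m == u, [disjoint L & z @: D] & L :|: z @: D \notin E]]|
    <= k ^ k * N ^ K.-1.
Proof.
move=> okL Ll LD mD c0D xc0 xcD.
set F := [set W : {set V} | [&& #|W| == k - #|L|, [disjoint L & W],
           [exists x in W, (x \in Ap) && (W :\ x \subset Bp)] & L :|: W \notin E]].
have cF W : W \in F -> #|W| = #|D| by rewrite inE => /andP[/eqP-> _]; lia.
have DK : #|D| < K.
  by have := max_card (mem (m |: D)); rewrite card_ord cardsU1 mD.
apply: (@leq_trans (Q * (#|F| * (#|D| ^ #|D| * N ^ (K - 1 - #|D|))))).
  rewrite leq_mul2l; apply/orP; right.
  rewrite -[K in _ ^ (K - _ - _)]card_ord.
  apply: leq_trans (count_prescribed_image u mD cF).
  apply: subset_leq_card; apply/subsetP => z; rewrite !inE.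
  case/and5P => /forallP tz /injectiveP iz -> dL ->; rewrite dL !andbT card_imset //=.
  rewrite -LD addKn eqxx /=; apply/exists_inP; exists (z c0); first exact: imset_f.
  have := tz c0; rewrite xc0 => /(subsetP XA) -> /=.
  apply/subsetP => w /setD1P[ne /imsetP[c cD e]]; rewrite {w}e in ne *.
  have ncx : ~~ is_xcol c by apply: xcD => //; apply: contraNneq ne => ->.
  by have := tz c; rewrite (negbTE ncx); apply: (subsetP YB).
rewrite mulnA [_ * (_ * _)]mulnC.
apply: leq_trans (bound (_ : #|D| <= k) DK); last by lia.
rewrite leq_mul2l; apply/orP; right.
by rewrite [X in _ ^ X](_ : _ = k - #|L|); [exact: few_nonedges_ok|lia].
Qed.

(** Here the prescribed entry [u] belongs to the window and is its vertex of [A'], the remaining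
    [k.-1] entries being in [Bp]. *)
Lemma few_bad_windows_Ap (D : {set 'I_K}) (m : 'I_K) (u : V) :
  u \in Ap -> #|D| = k.-1 -> m \notin D -> (forall c, c \in D -> ~~ is_xcol c) ->
  Q * #|[set z : {ffun 'I_K -> V} | [&& typed is_xcol X Y z, injectiveb z,
           z m == u & u |: z @: D \notin E]]|
    <= k ^ k * N ^ K.-1.
Proof.
move=> uA cD mD xcD.
set F := [set W : {set V} | [&& #|W| == k.-1, W \subset Bp & u |: W \notin E]].
have cF W : W \in F -> #|W| = #|D| by rewrite inE => /andP[/eqP-> _].
have DK : #|D| < K.
  by have := max_card (mem (m |: D)); rewrite card_ord cardsU1 mD.
apply: (@leq_trans (Q * (#|F| * (#|D| ^ #|D| * N ^ (K - 1 - #|D|))))).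
  rewrite leq_mul2l; apply/orP; right.
  rewrite -[K in _ ^ (K - _ - _)]card_ord.
  apply: leq_trans (count_prescribed_image u mD cF).
  apply: subset_leq_card; apply/subsetP => z; rewrite !inE.
  case/and4P => /forallP tz /injectiveP iz -> ->; rewrite card_imset // cD eqxx !andbT /=.
  apply/subsetP => _ /imsetP[c cD' ->]; have := tz c; rewrite (negbTE (xcD c cD')).
  exact: (subsetP YB).
rewrite mulnA [_ * (_ * _)]mulnC.
apply: leq_trans (bound (_ : #|D| <= k) DK); last by lia.
rewrite leq_mul2l; apply/orP; right.
by rewrite [X in _ ^ X]cD; exact: few_nonedges_Ap.
Qed.

Variables (lend rend : seq V).
Hypotheses (size_lend : size lend = l) (size_rend : size rend = l).
Hypotheses (uniq_lend : uniq lend) (uniq_rend : uniq rend).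
Hypothesis ok_lend : forall i, i.+1 < s -> ok [set x in drop (i * d) lend].
Hypothesis ok_rend : forall i, i.+1 < s -> ok [set x in take (l - i * d) rend].
Hypothesis lend_out : forall x, x \in lend -> x \notin X :|: Y.
Hypothesis rend_out : forall x, x \in rend -> x \notin X :|: Y.

Let D a := columns K (a - l) (minn (a + k - l) K).

(** A window starting in one of these ranges contains exactly one column of [is_xcol], the same for
    the whole range, because [s * d - d < k < s * d]. The gaps between the ranges contain no
    multiple of [d]. *)
Let block a := [|| a <= s * d - d, s * d <= a <= 2 * (s * d) - d
                 | 2 * (s * d) <= a <= 3 * (s * d) - d].

Let blockE (i : 'I_(3 * s)) : block (i * d) /\ i * d <= 3 * (s * d) - d.
Proof.
have i3 := ltn_ord i; rewrite /block.
have h1 : i < s -> i * d + d <= s * d.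
  by move=> h; rewrite -mulSnr leq_mul2r h orbT.
have h2 : s <= i -> s * d <= i * d by move=> h; rewrite leq_mul2r h orbT.
have h3 : i < 2 * s -> i * d + d <= 2 * (s * d).
  by move=> h; rewrite -mulSnr mulnA leq_mul2r h orbT.
have h4 : 2 * s <= i -> 2 * (s * d) <= i * d.
  by move=> h; rewrite mulnA leq_mul2r h orbT.
have h5 : i * d + d <= 3 * (s * d) by rewrite -mulSnr mulnA leq_mul2r i3 orbT.
lia.
Qed.

Let xcol_unique a : block a -> exists c0 : 'I_K,
  [/\ c0 \in D a, is_xcol c0 & forall c, c \in D a -> c != c0 -> ~~ is_xcol c].
Proof.
rewrite /block => ba.
have [v hv] : exists v, [|| (a <= s * d - d) && (v + l == s * d - d),
    (s * d <= a <= 2 * (s * d) - d) && (v + l == 2 * (s * d) - d)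
  | (2 * (s * d) <= a <= 3 * (s * d) - d) && (v + l == 3 * (s * d) - d)].
  case/or3P: ba => ba; [exists (s * d - d - l)|exists (2 * (s * d) - d - l)
                       |exists (3 * (s * d) - d - l)]; lia.
have vK : v < K by rewrite /K /conn_size; lia.
exists (Ordinal vK); split.
- by rewrite inE /= /K /conn_size; lia.
- by rewrite /is_xcol /=; lia.
move=> c; rewrite inE -val_eqE /= /is_xcol /K /conn_size; have := ltn_ord c; lia.
Qed.

Let card_D a : a <= 3 * (s * d) - d -> #|D a| = minn (a + k - l) K - (a - l).
Proof. by move=> h; rewrite card_columns // geq_minr. Qed.

Let window a (z : {ffun 'I_K -> V}) : a <= 3 * (s * d) - d ->
  [set x in take k (drop a (lend ++ codom z ++ rend))] =
  ([set x in drop a lend] :|: [set x in take (a + k - 3 * (s * d)) rend])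
    :|: z @: D a := connector_window par z size_lend size_rend.

Let set_seq_nil : [set x in [::] : seq V] = set0.
Proof. by apply/setP => x; rewrite !inE. Qed.

Let disjoint_ends (L : {set V}) (F : {set 'I_K}) (z : {ffun 'I_K -> V}) : typed is_xcol X Y z ->
  (forall x, x \in L -> x \notin X :|: Y) -> [disjoint L & z @: F].
Proof.
move=> /forallP tz out; apply/pred0P => x /=; apply/negbTE/negP => /andP[xL].
case/imsetP => c _ e; have := out x xL; rewrite e inE negb_or.
by have := tz c; case: ifP => _ ->; rewrite ?andbF.
Qed.

Let few_bad_end a (L : {set V}) b (u : V) : a <= 3 * (s * d) - d -> block a ->
  [set x in drop a lend] :|: [set x in take (a + k - 3 * (s * d)) rend] = L ->
  ok L -> #|L| <= l -> #|L| + #|D a| = k -> mid_col b \notin D a ->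
  (forall x, x \in L -> x \notin X :|: Y) ->
  Q * #|[set z : {ffun 'I_K -> V} | [&& typed is_xcol X Y z, injectiveb z,
     z (mid_col b) == u
    & [set x in take k (drop a (lend ++ codom z ++ rend))] \notin E]]|
    <= k ^ k * N ^ K.-1.
Proof.
move=> ha ba eL okL Ll LD mD out.
have [c0 [c0D xc0 uc0]] := xcol_unique ba.
apply: leq_trans (few_bad_windows u okL Ll LD mD c0D xc0 uc0).
rewrite leq_mul2l; apply/orP; right.
apply: subset_leq_card; apply/subsetP => z; rewrite !inE => /and4P[tz -> ->].
by rewrite tz window // eL => ->; rewrite (disjoint_ends _ tz out).
Qed.

(** Windows with [i.+1 < s] meet the left end, those with [i > 2 * s] the right end, and none of
    these contains a middle column. The others have all [k] entries in columns. If one of them is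
    the middle column, its entry [u] is fixed and plays the vertex of [A'] or the good set
    [[set u]], according to [b]. *)
Let few_bad_window (i : 'I_(3 * s)) b u : u \in (if b then X else Y) ->
  Q * #|[set z : {ffun 'I_K -> V} | [&& typed is_xcol X Y z, injectiveb z,
     z (mid_col b) == u
    & [set x in take k (drop (i * d) (lend ++ codom z ++ rend))] \notin E]]|
    <= k ^ k * N ^ K.-1.
Proof.
move=> uXY; have [bi hi] := blockE i; have bi' := bi; rewrite /block in bi'.
have i3 := ltn_ord i.
have [is1|is1] := ltnP i.+1 s.
  have h1 : i * d + d + d <= s * d.
    by rewrite -!mulSnr leq_mul2r is1 orbT.
  apply: (few_bad_end u (L := [set x in drop (i * d) lend])) => //.
  - rewrite (_ : i * d + k - _ = 0) ?take0; last by lia.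
    by rewrite set_seq_nil setU0.
  - exact: ok_lend.
  - by rewrite cardsE (card_uniqP _) ?drop_uniq // size_drop size_lend; lia.
  - rewrite card_D // cardsE (card_uniqP _) ?drop_uniq // size_drop size_lend.
    by rewrite /K /conn_size; lia.
  - by rewrite inE /mid_col /= /K /conn_size; case: (b) => /=; lia.
  - by move=> x; rewrite inE => /mem_drop /lend_out.
have h1 : s * d <= i * d + d by rewrite -mulSnr leq_mul2r is1 orbT.
have e1 : [set x in drop (i * d) lend] = set0.
  by rewrite drop_oversize ?set_seq_nil // size_lend; lia.
have [is2|is2] := ltnP (2 * s) i.
  have h2 : 2 * (s * d) + d <= i * d.
    by rewrite mulnA -mulSnr leq_mul2r is2 orbT.
  (* The trace on the right end is the prefix that [ok_rend] names with index [3 * s - i.+1]. *)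
  have e2 : i * d + k - 3 * (s * d) = l - (3 * s - i.+1) * d.
    have hm := mulnBl (3 * s) i.+1 d; rewrite [i.+1 * d]mulSnr -[3 * s * d]mulnA in hm.
    by lia.
  have c2 : #|[set x in take (i * d + k - 3 * (s * d)) rend]| = i * d + k - 3 * (s * d).
    by rewrite cardsE (card_uniqP _) ?take_uniq // size_takel // size_rend; lia.
  apply: (few_bad_end u (L := [set x in take (i * d + k - 3 * (s * d)) rend])) => //.
  - by rewrite e1 set0U.
  - by rewrite e2; apply: ok_rend; lia.
  - by rewrite c2; lia.
  - by rewrite c2 card_D // /K /conn_size; clear -h2 hi def_k k_lt_sd sd_lt_kd; lia.
  - by rewrite inE /mid_col /= /K /conn_size; case: (b) => /=; lia.
  - by move=> x; rewrite inE => /mem_take /rend_out.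
have h2 : i * d <= 2 * (s * d) by rewrite mulnA leq_mul2r is2 orbT.
have eL : [set x in drop (i * d) lend] :|: [set x in take (i * d + k - 3 * (s * d)) rend] = set0.
  rewrite e1 (_ : i * d + k - _ = 0) ?take0; last by lia.
  by rewrite set_seq_nil setU0.
have cD : #|D (i * d)| = k by rewrite card_D // /K /conn_size; lia.
have [mD|mD] := boolP (mid_col b \in D (i * d)); last first.
  by apply: (few_bad_end u (L := set0)) => //; rewrite ?cards0 ?cD // => x; rewrite inE.
have [c0 [c0D xc0 uc0]] := xcol_unique bi.
pose D' := D (i * d) :\ mid_col b.
have mD' : mid_col b \notin D' by rewrite !inE eqxx.
have cD' : #|D'| = k.-1 by have := cardsD1 (mid_col b) (D (i * d)); rewrite mD cD => ->.
have win (z : {ffun 'I_K -> V}) : z (mid_col b) == u ->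
  [set x in take k (drop (i * d) (lend ++ codom z ++ rend))]
  = u |: z @: D'.
  by move=> /eqP zu; rewrite window // eL set0U -[D (i * d)](setD1K mD) imsetU1 zu.
case: b uXY mD @D' mD' cD' win => uXY mD D' mD' cD' win.
  apply: leq_trans (few_bad_windows_Ap (subsetP XA _ uXY) cD' mD' _).
    rewrite leq_mul2l; apply/orP; right.
    apply: subset_leq_card; apply/subsetP => z; rewrite !inE => /and4P[-> -> zu].
    by rewrite win // zu.
  move=> c /setD1P[cm cD0]; apply: (uc0 c) => //.
  (* The middle column is itself the unique column of [is_xcol] in this window. *)
  suff -> : c0 = mid_col true by [].
  by apply/eqP; apply: contraT => h; have := uc0 _ mD; rewrite eq_sym h is_xcol_mid => /(_ isT).
have c0m : c0 != mid_col false.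
  by apply: contraTneq xc0 => ->; rewrite is_xcol_mid.
apply: leq_trans (few_bad_windows (L := [set u]) (D := D') (m := mid_col false)
  (c0 := c0) u _ _ _ _ _ _ _) => //.
- rewrite leq_mul2l; apply/orP; right.
  apply: subset_leq_card; apply/subsetP => z; rewrite !inE => /and4P[-> iz zu].
  rewrite iz zu win // => ->; rewrite andbT /=.
  rewrite disjoints1; apply/imsetP => -[c cD0 e]; move/eqP: zu; rewrite e => /(injectiveP _ iz) ec.
  by rewrite -ec (negbTE mD') in cD0.
- by apply: ok1; apply: (subsetP YB).
- by rewrite cards1 ltnW.
- by rewrite cards1 cD' add1n prednK // def_k addn_gt0 (ltnW l_ge2).
- by rewrite in_setD1 c0m.
- by move=> c /setD1P[_]; apply: uc0.
Qed.

Lemma few_bad_connectors b u : u \in (if b then X else Y) ->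
  Q * #|[set z : {ffun 'I_K -> V} | [&& typed is_xcol X Y z, injectiveb z,
           z (mid_col b) == u & ~~ connects k E lend rend z]]|
    <= 3 * s * (k ^ k * N ^ K.-1).
Proof.
move=> uXY.
pose bad_win (i : 'I_(3 * s)) := [set z : {ffun 'I_K -> V} |
  [&& typed is_xcol X Y z, injectiveb z, z (mid_col b) == u
    & [set x in take k (drop (i * d) (lend ++ codom z ++ rend))] \notin E]].
apply: (@leq_trans (Q * \sum_i #|bad_win i|)).
  rewrite leq_mul2l; apply/orP; right; apply: leq_trans (leq_card_bigcup _ _).
  apply: subset_leq_card; apply/subsetP => z; rewrite inE => /and4P[h1 h2 h3].
  by rewrite negb_forall => /existsP[i hi]; apply/bigcupP; exists i; rewrite // inE h1 h2 h3.
rewrite big_distrr /= -[3 * s in leqRHS]card_ord -sum_nat_const.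
by apply: leq_sum => i _; apply: few_bad_window.
Qed.

End Connector.

(** * Pieces *)

Lemma bin_leq_exp (n m : nat) : 'C(n, m) <= n ^ m.
Proof.
elim: n m => [|n IH] [|m] //.
rewrite binS (leq_trans (leq_add (IH _) (IH _))) // expnSr addnC -mulnS expnSr.
by rewrite leq_mul2r; apply/orP; right; case: m => // m; rewrite leq_exp2r.
Qed.

Section Pieces.

Variables (V : finType) (k l s d : nat) (E : {set {set V}}).
Hypothesis par : path_params k l s d.
Let d_ge2 : 2 <= d. Proof. by case: par. Qed.
Let l_ge2 : 2 <= l. Proof. by case: par. Qed.
Let def_k : k = l + d. Proof. by case: par. Qed.
Let k_lt_sd : k < s * d. Proof. by case: par => _ _ _ _ /andP[]. Qed.
Let sd_lt_kd : s * d < k + d. Proof. by case: par => _ _ _ _ /andP[]. Qed.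

Variables (Bp : {set V}) (ok : pred {set V}).

(* An l-path (possibly without edges, when size p = l) both of whose ends are
   linkable. *)
Definition piece (p : seq V) : Prop :=
  [/\ uniq p, l <= size p, d %| size p - l, window_path k d E p
    & forall i, i.+1 < s -> ok [set x in drop (i * d) (drop (size p - l) p)]
                         /\ ok [set x in take (l - i * d) p]].

(** Any [l] vertices of a clean set, in any order, form a linkable end. *)
Definition clean (W : {set V}) : Prop := forall L : {set V}, L \subset W -> #|L| <= l -> ok L.

(** Insert [v] at position [q] of a tight path in [F]. By [j.-1 * d <= q < k] all [j] edges contain
    [v], and each of them without [v] is a window of the tight path, hence in the link of [v]. By
    [l <= q < j * d] both ends avoid [v]. *)
Lemma gadget (v : V) (j q : nat) (U : {set V}) (F : {set {set V}}) :
  0 < j -> j <= s -> j.-1 * d <= q -> q < k -> l <= q -> q < j * d ->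
  v \notin U ->
  (forall W, W \in F -> [/\ #|W| = k.-1, W \subset U, clean W & v |: W \in E]) ->
  2 * k * 'C(#|U|, k.-2) < #|F| ->
  exists p : seq V, [/\ piece p, size p = l + j * d, v \in p
    & forall x, x \in p -> x = v \/ x \in U].
Proof.
case: j => // j _ js /= jq qk lq qj vU FU hF.
have jd : j.+1 * d = j * d + d by rewrite mulSnr.
have jsd : j.+1 * d <= s * d by rewrite leq_mul2r js orbT.
(* After the case analysis the path has [j.+1] edges, hence [T.+1] vertices including [v]. *)
pose T := j * d + k.-1.
have k2 : k.-2.+1 = k.-1 by lia.
have Tk : T <= 2 * k by rewrite /T; lia.
have kT : k.-1 <= T by rewrite /T; lia.
have [z [uz sz wz]] : exists z : seq V, [/\ uniq z, size z = T
    & forall i, i + k.-2 < T -> [set x in take k.-2.+1 (drop i z)] \in F].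
  apply: (@tight_path _ _ _ U); rewrite ?k2; first by move=> W /FU[].
  - by rewrite /T; lia.
  - by apply: leq_ltn_trans hF; rewrite leq_mul2r /T; apply/orP; right; lia.
rewrite k2 in wz.
have zU x : x \in z -> x \in U.
  move=> xz; have iz := xz; rewrite -index_mem sz in iz.
  (* A window of [z] that contains [x]; the last one starts at [j * d]. *)
  pose i := minn (index x z) (j * d).
  have /FU[_ /subsetP WU _ _] := wz i (ltac:(rewrite /i /T; lia)).
  apply: WU; rewrite inE -(nth_index x xz).
  rewrite (_ : nth x z (index x z) = nth x (take k.-1 (drop i z)) (index x z - i)).
    apply: mem_nth; rewrite size_take_min size_drop sz /i /T; rewrite /T in iz; lia.
  by rewrite nth_take ?nth_drop; [congr nth|]; rewrite /i /T in iz *; lia.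
have vz : v \notin z by apply: contra vU; apply: zU.
pose p := take q z ++ v :: drop q z.
have qz : q <= size z by rewrite sz /T; lia.
have stq : size (take q z) = q by rewrite size_takel.
have sp : size p = l + j.+1 * d.
  by rewrite size_cat /= stq size_drop sz /T; lia.
have pvz : perm_eq p (v :: z).
  by rewrite /p -cat1s perm_catCA /= cat_take_drop.
have up : uniq p.
  have -> : uniq p = uniq (v :: z) by rewrite -(perm_uniq pvz).
  by rewrite /= vz.
have pE x : x \in p = (x == v) || (x \in z) by rewrite (perm_mem pvz) inE.
exists p; split=> //; last first.
- by move=> x; rewrite pE => /orP[/eqP ->|/zU]; [left|right].
- by rewrite pE eqxx.
have cl a : a + k.-2 < T -> clean [set x in take k.-1 (drop a z)].
  by move=> /wz /FU[].
split=> //.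
- by rewrite sp; lia.
- by rewrite sp addKn dvdn_mull.
- move=> i hi; rewrite sp in hi.
  have hij : i * d <= j * d by lia.
  have [] := FU _ (wz (i * d) (ltac:(rewrite /T; lia))).
  move=> _ _ _; congr (_ \in E); apply/setP => x.
  have -> : take k (drop (i * d) p) = drop (i * d) (take q z) ++
      v :: take (k.-1 - (q - i * d)) (drop q z).
    rewrite /p drop_cat_sub take_cat_sub size_drop stq (_ : i * d - q = 0); last by lia.
    rewrite drop0 take_oversize ?size_drop ?stq; last by lia.
    by rewrite (_ : k - (q - i * d) = (k.-1 - (q - i * d)).+1) //; lia.
  have -> : take k.-1 (drop (i * d) z) = drop (i * d) (take q z) ++
      take (k.-1 - (q - i * d)) (drop q z).
    rewrite -[z in LHS](cat_take_drop q) drop_cat_sub take_cat_sub size_drop stq.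
    rewrite (_ : i * d - q = 0) ?drop0; last by lia.
    by rewrite take_oversize // size_drop stq; lia.
  by rewrite !inE !mem_cat !inE; lia.
(* The left end lies in the first window of [z], the right end in the last one, and both windows are
   clean. *)
- move=> i i1s; split; last first.
    apply: (cl 0); first by rewrite /T; lia.
      apply/subsetP => x; rewrite !inE drop0 /p take_cat_sub stq.
      rewrite (_ : l - _ - q = 0) ?take0 ?cats0; last by lia.
      rewrite take_takel; last by lia.
      rewrite -(subnKC (_ : l - i * d <= k.-1)); last by lia.
      by rewrite takeD mem_cat => ->.
    by rewrite cardsE; apply: leq_trans (card_size _) _; rewrite size_take_min; lia.
  rewrite sp addKn; apply: (cl (j * d)); first by rewrite /T; lia.
    apply/subsetP => x; rewrite !inE => /mem_drop.
    rewrite /p drop_cat_sub [drop _ (take q z)]drop_oversize ?stq; last by lia.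
    rewrite (_ : j.+1 * d - q = (j.+1 * d - q).-1.+1) /=; last by lia.
    rewrite drop_drop take_oversize; last by rewrite size_drop sz /T; lia.
    rewrite (_ : _ + q = (d.-1) + j * d) -?drop_drop; last by lia.
    exact: mem_drop.
  rewrite cardsE; apply: leq_trans (card_size _) _; rewrite !size_drop sp; lia.
Qed.

(** [cap] limits the number of vertices in use that a new gadget has to avoid. *)
Variable cap : nat.
Hypothesis avail : forall (v : V) (U : {set V}), v \notin Bp -> #|U| <= cap ->
  exists F : {set {set V}},
    (forall W, W \in F -> [/\ #|W| = k.-1, W \subset Bp :\: U, clean W & v |: W \in E])
    /\ 2 * k * #|V| ^ k.-2 < #|F|.

Lemma greedy_gadgets (j q : nat) :
  0 < j -> j <= s -> j.-1 * d <= q -> q < k -> l <= q -> q < j * d ->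
  forall (vs : seq V) (U : {set V}), uniq vs -> (forall v, v \in vs -> v \notin Bp) ->
  #|U| + size vs * (l + j * d) <= cap ->
  exists ps : seq (seq V), [/\ size ps = size vs,
    forall p, p \in ps -> piece p /\ size p = l + j * d,
    uniq (flatten ps), {subset vs <= flatten ps}
    & forall x, x \in flatten ps -> x \in vs \/ x \in Bp :\: U].
Proof.
move=> j0 js jq qk lq qj; elim=> [|v vs IH] U /=; first by exists [::].
case/andP=> vvs uvs vsB cU.
have [||F [FU hF]] := avail (v := v) (U := U); first by apply: vsB; rewrite inE eqxx.
  by move: cU; rewrite mulSn; lia.
have vB : v \notin Bp :\: U by rewrite inE negb_and vsB ?orbT // inE eqxx.
have hF' : 2 * k * 'C(#|Bp :\: U|, k.-2) < #|F|.
  apply: leq_ltn_trans hF; rewrite leq_mul2l; apply/orP; right.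
  by apply: leq_trans (bin_leq_exp _ _) _; rewrite ?leq_exp2r ?max_card //; lia.
have [p [pp sp vp pU]] := gadget j0 js jq qk lq qj vB FU hF'.
have [|||ps [sps pps ups vps psU]] := IH (U :|: [set x in p]) => //.
- by move=> w wvs; apply: vsB; rewrite inE wvs orbT.
- move: cU; rewrite mulSn cardsU cardsE (card_uniqP _); last by case: pp.
  by rewrite sp; lia.
exists (p :: ps); split.
- by rewrite /= sps.
- by move=> p'; rewrite inE => /orP[/eqP->|/pps].
- rewrite /= cat_uniq ups andbT; apply/andP; split; first by case: pp.
  apply/hasPn => x /psU [xvs|]; last by rewrite !inE negb_or => /andP[/andP[]].
  apply/negP => /pU [xv|]; first by rewrite -xv xvs in vvs.
  by rewrite inE (negbTE (vsB x _)) ?andbF // inE xvs orbT.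
- move=> x; rewrite inE /= mem_cat => /orP[/eqP->|/vps->]; first by rewrite vp.
  by rewrite orbT.
move=> x /=; rewrite mem_cat => /orP[/pU[->|]|/psU[xvs|]].
- by left; rewrite inE eqxx.
- by right.
- by left; rewrite inE xvs orbT.
- by rewrite !inE negb_or => /andP[/andP[-> _] ->]; right.
Qed.

Variable bare_cap : nat.
Hypothesis bare_avail : forall U : {set V}, #|U| <= bare_cap ->
  exists W : {set V}, [/\ #|W| = l, W \subset Bp :\: U & clean W].

Lemma greedy_bare (f : nat) (U : {set V}) : #|U| + f * l <= bare_cap ->
  exists ps : seq (seq V), [/\ size ps = f,
    forall p, p \in ps -> piece p /\ size p = l, uniq (flatten ps)
    & forall x, x \in flatten ps -> x \in Bp :\: U].
Proof.
elim: f U => [|f IH] U cU; first by exists [::].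
have [|W [cW WU clW]] := bare_avail (U := U); first by move: cU; rewrite mulSn; lia.
have [|ps [sps pps ups psU]] := IH (U :|: W).
  by move: cU; rewrite mulSn cardsU cW; lia.
have sW : size (enum W) = l by rewrite -cardE.
have pW : piece (enum W).
  split; rewrite ?enum_uniq ?sW ?subnn //.
  - by move=> i; rewrite sW; lia.
  move=> i _; rewrite drop0; split; apply: clW.
  - by apply/subsetP => x; rewrite inE => /mem_drop; rewrite mem_enum.
  - by rewrite cardsE; apply: leq_trans (card_size _) _; rewrite size_drop sW leq_subr.
  - by apply/subsetP => x; rewrite inE => /mem_take; rewrite mem_enum.
  - by rewrite cardsE; apply: leq_trans (card_size _) _; rewrite size_take_min sW geq_minr.
exists (enum W :: ps); split.
- by rewrite /= sps.
- by move=> p; rewrite inE => /orP[/eqP->|/pps].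
- rewrite /= cat_uniq ups enum_uniq andbT; apply/hasPn => x /psU.
  by rewrite !inE negb_or mem_enum => /andP[/andP[]].
move=> x /=; rewrite mem_cat mem_enum => /orP[/(subsetP WU)//|/psU].
by rewrite !inE negb_or => /andP[/andP[-> _] ->].
Qed.

End Pieces.

(** * Closing the cycle with connectors *)

Lemma exists_injection (S T : finType) (y0 : T) (A : {set S}) (B : {set T}) :
  #|A| = #|B| -> exists f : S -> T, {in A &, injective f} /\ {in A, forall x, f x \in B}.
Proof.
move=> AB; exists (fun x => nth y0 (enum B) (index x (enum A))).
have lt x : x \in A -> index x (enum A) < size (enum B).
  by move=> xA; rewrite -cardE -AB cardE index_mem mem_enum.
split=> [x y xA yA|x xA]; last by rewrite -mem_enum mem_nth // lt.
move=> /eqP; rewrite nth_uniq ?lt ?enum_uniq // => /eqP e.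
have : nth x (enum A) (index x (enum A)) = nth x (enum A) (index y (enum A)) by rewrite e.
by rewrite !nth_index ?mem_enum.
Qed.

Lemma perm_flatten_cat (T : eqType) (I : Type) (f g : I -> seq T) (r : seq I) :
  perm_eq (flatten [seq f i ++ g i | i <- r])
          (flatten [seq f i | i <- r] ++ flatten [seq g i | i <- r]).
Proof.
elim: r => [|i r IH] //=; rewrite -!catA perm_cat2l perm_sym perm_catCA perm_cat2l.
by rewrite perm_sym.
Qed.

(** The conditions on [M] and [Q] make each summand on the left at most a quarter of [M ^ K]. *)
Lemma reshuffle_numerics (K M N Q c C : nat) : 1 < K -> 0 < M -> 0 < Q -> N <= c * M ->
  4 * K.+1 ^ 2 <= M -> 4 * K.+1 * (C * c ^ K.-1) <= Q ->
  K.+1 * (M * ((C * N ^ K.-1) %/ Q)) + K.+1 * K.+1 * M ^ K.-1 < M ^ K.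
Proof.
move=> K1 M0 Q0 NM hM hQ.
set P := M ^ K.-1.
have P0 : 0 < P by rewrite expn_gt0 M0.
have -> : M ^ K = M * P by rewrite -expnS prednK //; lia.
set beta := _ %/ _.
have h2 : 4 * K.+1 * beta <= P.
  rewrite -(leq_pmul2l Q0); apply: (@leq_trans (4 * K.+1 * (C * N ^ K.-1))).
    by rewrite mulnCA leq_mul2l [Q * _]mulnC leq_trunc_div orbT.
  apply: (@leq_trans (4 * K.+1 * (C * c ^ K.-1) * P)); last by rewrite leq_mul2r hQ orbT.
  rewrite -!mulnA !leq_mul2l -expnMn leq_exp2r ?NM ?orbT //; lia.
have h3 : M * (4 * K.+1 * beta) <= M * P by rewrite leq_mul2l h2 orbT.
have h4 : 4 * K.+1 ^ 2 * P <= M * P by rewrite leq_mul2r hM orbT.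
have MP : 0 < M * P by rewrite muln_gt0 M0.
have e1 : K.+1 * (M * beta) * 4 = M * (4 * K.+1 * beta).
  by rewrite mulnC -!mulnA [M * (4 * _)]mulnCA [M * (K.+1 * _)]mulnCA.
have e2 : K.+1 * K.+1 * P * 4 = 4 * K.+1 ^ 2 * P by rewrite mulnn mulnC mulnA.
move: h3 h4 MP; rewrite -e1 -e2; lia.
Qed.

Section Finish.

Variables (V : finType) (k l s d : nat) (E : {set {set V}}).
Hypothesis par : path_params k l s d.
Let d_ge2 : 2 <= d. Proof. by case: par. Qed.
Let s_ge2 : 2 <= s. Proof. by case: par. Qed.
Let l_ge2 : 2 <= l. Proof. by case: par. Qed.
Let def_k : k = l + d. Proof. by case: par. Qed.
Let k_lt_sd : k < s * d. Proof. by case: par => _ _ _ _ /andP[]. Qed.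
Let sd_lt_kd : s * d < k + d. Proof. by case: par => _ _ _ _ /andP[]. Qed.

Variables (Ap Bp : {set V}) (ok : pred {set V}) (Q : nat).
Hypothesis ok0 : ok set0.
Hypothesis ok1 : forall u, u \in Bp -> ok [set u].
Hypothesis few_nonedges_Ap : forall x, x \in Ap ->
  Q * #|[set W : {set V} | [&& #|W| == k.-1, W \subset Bp & x |: W \notin E]]|
    <= #|V| ^ k.-1.
Hypothesis few_nonedges_ok : forall L : {set V}, ok L -> #|L| <= l ->
  Q * #|[set W : {set V} | [&& #|W| == k - #|L|, [disjoint L & W],
           [exists x in W, (x \in Ap) && (W :\ x \subset Bp)]
         & L :|: W \notin E]]| <= #|V| ^ (k - #|L|).

Let K := conn_size l s d.
Let N := #|V|.

Variables (pcs : seq (seq V)) (c : nat).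
Let M := size pcs.
Let Z : {set V} := [set x in flatten pcs].
Let X := Ap :\: Z.
Let Y := Bp :\: Z.

Hypothesis disjoint_AB : [disjoint Ap & Bp].
Hypothesis pcs_piece : forall p, p \in pcs -> piece k l s d E ok p.
Hypothesis uniq_pcs : uniq (flatten pcs).
Hypothesis card_X : #|X| = 3 * M.
Hypothesis card_Y : #|Y| = (K - 3) * M.
Hypothesis card_V : N = size (flatten pcs) + K * M.
Hypothesis N_le : N <= c * M.
Hypotheses (M_gt0 : 0 < M) (Q_gt0 : 0 < Q).

Let KE : K + l = 3 * (s * d) := conn_sizeE par.

Let beta := (3 * s * k ^ k * N ^ K.-1) %/ Q.

Let pc (j : nat) : seq V := nth [::] pcs j.
Let rend_of (j : nat) : seq V := drop (size (pc j) - l) (pc j).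
Let nxt (j : 'I_M) : nat := j.+1 %% M.
Let good (j : 'I_M) (z : {ffun 'I_K -> V}) : bool :=
  connects k E (rend_of j) (take l (pc (nxt j))) z.

Let pc_piece j : j < M -> piece k l s d E ok (pc j).
Proof. by move=> jM; apply: pcs_piece; apply: mem_nth. Qed.

Let pc_Z j x : j < M -> x \in pc j -> x \in Z.
Proof.
by move=> jM xj; rewrite inE; apply/flattenP; exists (pc j) => //; apply: mem_nth.
Qed.

Let few_bad (j : 'I_M) b u : u \in (if b then X else Y) ->
  #|[set z : {ffun 'I_K -> V} | [&& typed is_xcol X Y z, injectiveb z,
       z (mid_col par b) == u & ~~ good j z]]| <= beta.
Proof.
move=> uXY.
have nM : nxt j < M by rewrite ltn_mod.
have [u1 s1 _ _ e1] := pc_piece (ltn_ord j).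
have [u2 s2 _ _ e2] := pc_piece nM.
rewrite leq_divRL // mulnC -[3 * s * _ * _]mulnA.
apply: (few_bad_connectors par ok0 ok1 few_nonedges_Ap few_nonedges_ok) => //.
all: rewrite ?subsetDl ?drop_uniq ?take_uniq ?size_drop ?size_takel //.
- by rewrite subKn.
- by move=> i /e1[].
- by move=> i /e2[_]; rewrite take_takel // leq_subr.
- by move=> x /mem_drop /(pc_Z (ltn_ord j)) xZ; rewrite !in_setU !in_setD xZ.
- by move=> x /mem_take /(pc_Z nM) xZ; rewrite !in_setU !in_setD xZ.
Qed.

(** No edge is required yet, and the sizes of [X] and [Y] match the numbers of columns of the two
    types exactly. *)
Let initial : exists a : 'I_M -> {ffun 'I_K -> V}, arrangement is_xcol X Y a.
Proof.
have [x0 _] : exists x, x \in X by apply/card_gt0P; rewrite card_X; lia.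
pose C := [set x | is_xcol (x : 'I_K)].
have cC : #|~: C| = K - 3 by have := cardsC C; rewrite (card_xcol par) card_ord -/K; lia.
have [f [fi fX]] : exists f : 'I_M * 'I_K -> V, {in setX setT C &, injective f}
    /\ {in setX setT C, forall p, f p \in X}.
  by apply: exists_injection x0 _ _ _; rewrite cardsX cardsT card_ord (card_xcol par) card_X mulnC.
have [g [gi gY]] : exists f : 'I_M * 'I_K -> V, {in setX setT (~: C) &, injective f}
    /\ {in setX setT (~: C), forall p, f p \in Y}.
  by apply: exists_injection x0 _ _ _; rewrite cardsX cardsT card_ord cC card_Y mulnC.
have inC (j : 'I_M) (x : 'I_K) : ((j, x) \in setX setT C) = is_xcol x.
  by rewrite in_setX in_setT inE.
have inC' (j : 'I_M) (x : 'I_K) : ((j, x) \in setX setT (~: C)) = ~~ is_xcol x.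
  by rewrite in_setX in_setT !inE.
have XY x : x \in X -> x \in Y -> False.
  rewrite !inE => /andP[_ xA] /andP[_ xB].
  by have := disjointFr disjoint_AB xA; rewrite xB.
exists (fun j => [ffun x => if is_xcol x then f (j, x) else g (j, x)]); split; last first.
  move=> j; apply/forallP => x; rewrite ffunE; case: ifP => xc.
    by apply: fX; rewrite inC.
  by apply: gY; rewrite inC' xc.
move=> [j x] [j' x'] /=; rewrite !ffunE; case: ifP => xc; case: ifP => xc' h.
- by apply: fi; rewrite ?inC.
- case: (XY (f (j, x))); first by apply: fX; rewrite inC.
  by rewrite h; apply: gY; rewrite inC' xc'.
- case: (XY (f (j', x'))); first by apply: fX; rewrite inC.
  by rewrite -h; apply: gY; rewrite inC' xc.
- by apply: gi; rewrite ?inC' ?xc ?xc'.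
Qed.

Let large : 4 * K.+1 ^ 2 <= M -> 4 * K.+1 * (3 * s * k ^ k * c ^ K.-1) <= Q ->
  K.+1 * (#|'I_M| * beta) + K.+1 * K.+1 * #|'I_M| ^ K.-1 < #|'I_M| ^ K.
Proof.
move=> M_ge Q_ge; rewrite card_ord; apply: reshuffle_numerics M_ge Q_ge.
- by clear -KE l_ge2 def_k k_lt_sd; lia.
- exact: M_gt0.
- exact: Q_gt0.
- exact: N_le.
Qed.

(** A block is a piece followed by its connector. Since [K + l = 3 * (s * d)], its length is
    divisible by [d], so the edges stay aligned around the cycle. The entries are distinct and
    number [N], hence exhaust [V]. *)
Lemma hamilton_of_pieces :
  4 * K.+1 ^ 2 <= M -> 4 * K.+1 * (3 * s * k ^ k * c ^ K.-1) <= Q ->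
  hamilton_lcycle k l E.
Proof.
move=> M_ge Q_ge; have [a0 arr0] := initial.
have [a [[ia ta] ga]] := reshuffle (is_xcol_mid par) few_bad (large M_ge Q_ge) arr0.
have kl : k - l = d by rewrite def_k addKn.
clear M_ge Q_ge.
(* Indices are reduced modulo [M], so block [M] is block [0] and the chain closes up. *)
pose o (j : nat) : 'I_M := Ordinal (ltn_pmod j M_gt0).
pose b (j : nat) := pc (o j) ++ codom (a (o j)).
have sb j : l <= size (pc (o j)) by have [] := pc_piece (ltn_ord (o j)).
have db j : d %| size (b j).
  have [_ lp dp _ _] := pc_piece (ltn_ord (o j)).
  rewrite size_cat size_codom card_ord.
  rewrite (_ : _ + _ = (size (pc (o j)) - l) + 3 * s * d).
    by rewrite dvdn_add // dvdn_mull.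
  by rewrite -mulnA -KE addnCA subnK // addnC.
have tb j : take l (b j) = take l (pc (o j)) by rewrite takel_cat.
have wb j : window_path k d E (b j ++ take l (b j.+1)).
  rewrite tb /b -[X in X ++ codom _](cat_take_drop (size (pc (o j)) - l)) -!catA.
  have [_ lp dp wp _] := pc_piece (ltn_ord (o j)).
  apply: window_path_glue.
  - by rewrite size_takel // leq_subr.
  - by rewrite size_drop subKn // def_k.
  - by rewrite cat_take_drop.
  have := ga (o j); rewrite /good => /(connectsP par).
  rewrite /nxt (_ : (o j).+1 %% M = o j.+1); last by rewrite /= -addn1 modnDml addn1.
  by apply=> //; rewrite ?size_drop ?size_takel ?subKn //.
have hM : M.-1.+1 = M by rewrite prednK.
pose cyc := flatten [seq b j | j <- iota 0 M].
have pcyc : perm_eq cyc (flatten pcs ++ [seq a j x | j <- enum 'I_M, x <- enum 'I_K]).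
  apply: perm_trans (perm_flatten_cat _ _ _) _; apply: perm_cat.
    rewrite (_ : [seq pc (o j) | j <- iota 0 M] = pcs) //.
    rewrite -[RHS](mkseq_nth [::]); apply/eq_in_map => j.
    by rewrite mem_iota add0n => /andP[_ jM]; rewrite /pc /= modn_small.
  rewrite -val_enum_ord -map_comp (eq_map (g := fun j => [seq a j x | x <- enum 'I_K])) //.
  move=> j; rewrite [in LHS]/= (_ : o j = j) //.
  by apply/val_inj; rewrite /= modn_small.
have ucyc : uniq cyc.
  rewrite (perm_uniq pcyc) cat_uniq uniq_pcs /=; apply/andP; split; last first.
    apply: allpairs_uniq; rewrite ?enum_uniq // => -[j x] [j' x'] _ _ /=.
    exact: (ia (_, _) (_, _)).
  apply/hasPn => _ /allpairsP[[j x] [_ _ ->]] /=.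
  have /forallP /(_ x) := ta j.
  by case: ifP => _; rewrite in_setD in_set => /andP[].
have scyc : size cyc = N.
  by rewrite (perm_size pcyc) size_cat size_allpairs -!cardE !card_ord card_V mulnC.
exists cyc; split=> //.
- move=> x; rewrite inE.
  have /card_uniqP e := ucyc.
  have : #|cyc| == #|V| by rewrite e scyc.
  by move=> /eqP h; apply: (subset_cardP h (subset_predT _)).
- rewrite kl /cyc; elim: (iota 0 M) => [|j r IH] /=; first by rewrite dvdn0.
  by rewrite size_cat dvdn_add.
rewrite kl => i hi; rewrite /cycle_edge kl.
apply: (window_path_cycle (l := l)) hi => //.
- rewrite /cyc; elim: (iota 0 M) => [|j r IH] /=; first by rewrite dvdn0.
  by rewrite size_cat dvdn_add.
- rewrite scyc card_V; apply: leq_trans (leq_addl _ _).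
  apply: (@leq_trans (K * 1)); last by rewrite leq_mul2l M_gt0 orbT.
  by rewrite muln1 -(leq_add2r l) KE; clear -def_k k_lt_sd; lia.
have lb j : l <= size (b j) by rewrite size_cat (leq_trans (sb j)) // leq_addr.
have := window_path_chain (m := M.-1) (esym def_k) db lb wb; rewrite hM -/cyc.
have -> : take l (b M) = take l cyc; last by [].
rewrite /cyc -hM /= takel_cat ?lb //.
rewrite !tb; congr (take l (pc _)); rewrite /= hM modnn mod0n //.
Qed.

End Finish.

(** * Choice and number of the pieces *)

Lemma size_flatten_const (T : eqType) (m : nat) (ps : seq (seq T)) :
  (forall p, p \in ps -> size p = m) -> size (flatten ps) = size ps * m.
Proof.
elim: ps => [|p ps IH] //= h; rewrite size_cat h ?inE ?eqxx // IH ?mulSn //.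
by move=> p' hp'; apply: h; rewrite inE hp' orbT.
Qed.

Lemma card_set_seq_le (T : finType) (p : seq T) : #|[set x in p]| <= size p.
Proof. by rewrite cardsE card_size. Qed.

Section Assembly.

Variables (V : finType) (k l s d : nat) (E : {set {set V}}).
Hypothesis par : path_params k l s d.

Variables (Ap Bp : {set V}) (ok : pred {set V}) (Q cap bare_cap c : nat).
Hypothesis ok0 : ok set0.
Hypothesis ok1 : forall u, u \in Bp -> ok [set u].
Hypothesis few_nonedges_Ap : forall x, x \in Ap ->
  Q * #|[set W : {set V} | [&& #|W| == k.-1, W \subset Bp & x |: W \notin E]]|
    <= #|V| ^ k.-1.
Hypothesis few_nonedges_ok : forall L : {set V}, ok L -> #|L| <= l ->
  Q * #|[set W : {set V} | [&& #|W| == k - #|L|, [disjoint L & W],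
           [exists x in W, (x \in Ap) && (W :\ x \subset Bp)]
         & L :|: W \notin E]]| <= #|V| ^ (k - #|L|).
Hypothesis avail : forall (v : V) (U : {set V}), v \notin Bp -> #|U| <= cap ->
  exists F : {set {set V}},
    (forall W, W \in F ->
       [/\ #|W| = k.-1, W \subset Bp :\: U, clean l ok W & v |: W \in E])
    /\ 2 * k * #|V| ^ k.-2 < #|F|.
Hypothesis bare_avail : forall U : {set V}, #|U| <= bare_cap ->
  exists W : {set V}, [/\ #|W| = l, W \subset Bp :\: U & clean l ok W].
Hypothesis disjoint_AB : [disjoint Ap & Bp].

Let K := conn_size l s d.
Let V0 : {set V} := ~: (Ap :|: Bp).

(* t is the number of vertices of A' that are to be put into pieces with only
   s - 1 edges. *)
Lemma hamilton_assembly (ps : seq (seq V)) (n' mP t : nat) :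
  (forall p, p \in ps -> piece k l s d E ok p) -> uniq (flatten ps) ->
  {subset flatten ps <= Bp} -> size (flatten ps) = size ps * l + mP * d ->
  #|V| = n' * d -> s * #|~: Bp| + mP = n' + t ->
  size (flatten ps) + (#|V0| + t + 2) * (2 * k) <= cap ->
  3 * (size ps + #|V0| + t + 2) + t + 2 <= #|Ap| ->
  3 * cap + #|Ap| * l <= 3 * bare_cap ->
  3 * #|V| <= c * (#|Ap| - t - 2) ->
  3 * (4 * K.+1 ^ 2) <= #|Ap| - t - 2 ->
  4 * K.+1 * (3 * s * k ^ k * c ^ K.-1) <= Q ->
  hamilton_lcycle k l E.
Proof.
move=> ps_piece uniq_ps ps_B size_ps card_V edges hcap hAp hbare.
have [d_ge2 s_ge2 l_ge2 def_k /andP[k_lt_sd sd_lt_kd]] := par.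
(* Each connector takes three vertices of [A']. The remainder [e] goes into gadgets with [s] edges,
   and [M] is the number of connectors, hence of pieces. *)
pose e := (#|Ap| - t) %% 3; pose M := (#|Ap| - t) %/ 3.
have e2 : e <= 2 by rewrite -ltnS ltn_mod.
have ApE : #|Ap| = t + e + 3 * M.
  by have := divn_eq (#|Ap| - t) 3; rewrite -/e -/M; lia.
(* The number of bare [l]-tuples that brings the pieces up to [M]. *)
pose f := M - (size ps + #|V0| + t + e).
have fM : M = size ps + #|V0| + t + e + f by rewrite /f; lia.
pose vt := take t (enum Ap); pose ve := take e (drop t (enum Ap)).
have svt : size vt = t by rewrite size_takel // -cardE; lia.
have sve : size ve = e by rewrite size_takel // size_drop -cardE; lia.
have uvt : uniq (vt ++ ve).
  move: (enum_uniq Ap).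
  rewrite -{1}(cat_take_drop t (enum Ap)) -{1}(cat_take_drop e (drop t (enum Ap))) catA.
  by rewrite cat_uniq => /and3P[].
have vtA x : x \in vt -> x \in Ap by move=> /mem_take; rewrite mem_enum.
have veA x : x \in ve -> x \in Ap by move=> /mem_take /mem_drop; rewrite mem_enum.
have AB x : x \in Ap -> x \in Bp = false by apply: (disjointFr disjoint_AB).
pose vs := enum V0 ++ ve.
have V0N x : x \in V0 -> (x \in Ap) = false /\ (x \in Bp) = false.
  by rewrite !inE negb_or => /andP[/negbTE -> /negbTE ->].
have uvs : uniq vs.
  rewrite cat_uniq enum_uniq /=; apply/andP; split.
    by apply/hasPn => x /veA xA; rewrite /= mem_enum; apply/negP => /V0N[]; rewrite xA.
  by move: uvt; rewrite cat_uniq => /and3P[].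
have svs : size vs = #|V0| + e by rewrite size_cat -cardE sve.
have vsB v : v \in vs -> v \notin Bp.
  by rewrite mem_cat mem_enum => /orP[/V0N[_ ->]|/veA /AB ->].
have vtB v : v \in vt -> v \notin Bp by move=> /vtA /AB ->.
have vst x : x \in vt -> x \notin vs.
  move=> xt; rewrite mem_cat mem_enum negb_or; apply/andP; split.
    by apply/negP => /V0N[]; rewrite vtA.
  by move: uvt; rewrite cat_uniq => /and3P[_ /hasPn h _]; apply/negP => /h /=; rewrite xt.
have lsd : l + s * d <= 2 * k by lia.
have sd1 : s.-1 * d + d = s * d by rewrite -mulSnr prednK; lia.
pose U1 : {set V} := [set x in flatten ps].
(* Position [s.-1 * d] lies in all [s] edges and outside both ends, since [l < s.-1 * d < k]. *)
have [|||||||Gs [sGs Gs_piece uGs Gs_vs Gs_sub]] :=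
    greedy_gadgets par avail (j := s) (q := s.-1 * d) _ _ _ _ _ _ (vs := vs) (U := U1) uvs vsB.
- by lia.
- by [].
- by [].
- by lia.
- by lia.
- by lia.
- apply: leq_trans hcap; apply: leq_add; first exact: card_set_seq_le.
  by rewrite svs; apply: leq_mul => //; lia.
pose U2 : {set V} := [set x in flatten ps ++ flatten Gs].
have size_Gs : size (flatten Gs) = size vs * (l + s * d).
  by rewrite -sGs; apply: size_flatten_const => p /Gs_piece[].
have s2d : s.-1.-1 * d + d = s.-1 * d by rewrite -mulSnr prednK; lia.
(* With [s.-1] edges position [l] serves, because [s.-1.-1 * d <= l < s.-1 * d]. *)
have [||||||||Gt [sGt Gt_piece uGt Gt_vt Gt_sub]] :=
    greedy_gadgets par avail (j := s.-1) (q := l) _ _ _ _ _ _ (vs := vt) (U := U2) _ vtB.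
- by lia.
- by lia.
- by lia.
- by lia.
- by [].
- by lia.
- by move: uvt; rewrite cat_uniq => /and3P[].
- apply: leq_trans hcap; apply: leq_trans (leq_add (card_set_seq_le _) (leqnn _)) _.
  rewrite size_cat size_Gs svs svt -addnA leq_add2l.
  apply: (@leq_trans ((#|V0| + e) * (2 * k) + t * (2 * k))).
    by apply: leq_add; apply: leq_mul => //; lia.
  by rewrite -mulnDl leq_mul2r; apply/orP; right; lia.
pose U3 : {set V} := [set x in flatten ps ++ flatten Gs ++ flatten Gt].
have size_Gt : size (flatten Gt) = t * (l + s.-1 * d).
  by rewrite -svt -sGt; apply: size_flatten_const => p /Gt_piece[].
have [|Bs [sBs Bs_piece uBs Bs_sub]] := greedy_bare E par bare_avail (f := f) (U := U3).
  have h1 : #|U3| <= cap.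
    apply: leq_trans hcap; apply: leq_trans (card_set_seq_le _) _.
    rewrite !size_cat size_Gs size_Gt svs leq_add2l.
    apply: (@leq_trans ((#|V0| + e) * (2 * k) + t * (2 * k))).
      by apply: leq_add; apply: leq_mul => //; lia.
    by rewrite -mulnDl leq_mul2r; apply/orP; right; lia.
  have h2 : 3 * (f * l) <= #|Ap| * l by rewrite mulnA leq_mul2r; apply/orP; right; lia.
  lia.
have size_Bs : size (flatten Bs) = f * l.
  by rewrite -sBs; apply: size_flatten_const => p /Bs_piece[].
pose pcs := ps ++ Gs ++ Gt ++ Bs.
have size_pcs : size pcs = M.
  by rewrite !size_cat sGs sGt sBs svs svt fM; clear; lia.
have flat_pcs : flatten pcs = flatten ps ++ flatten Gs ++ flatten Gt ++ flatten Bs.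
  by rewrite !flatten_cat.
have uniq_pcs : uniq (flatten pcs).
  rewrite flat_pcs !cat_uniq uniq_ps uGs uGt uBs /= !andbT.
  apply/and3P; split.
  - apply/hasPn => x; rewrite !mem_cat => /or3P[/Gs_sub|/Gt_sub|/Bs_sub].
    + move=> [/vsB xB|]; first by apply: contra xB; apply: ps_B.
      by rewrite !inE => /andP[].
    + move=> [/vtB xB|]; first by apply: contra xB; apply: ps_B.
      by rewrite !inE mem_cat negb_or => /andP[/andP[]].
    + by rewrite !inE !mem_cat !negb_or => /andP[/andP[]].
  - apply/hasPn => x; rewrite !mem_cat => /orP[/Gt_sub|/Bs_sub].
    + move=> [xt|]; last by rewrite !inE mem_cat negb_or => /andP[/andP[]].
      apply/negP => /Gs_sub[|]; first by apply/negP/vst.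
      by rewrite inE (negbTE (vtB _ xt)) andbF.
    + by rewrite !inE !mem_cat !negb_or => /andP[/and3P[]].
  - apply/hasPn => x /Bs_sub.
    by rewrite !inE !mem_cat !negb_or => /andP[/and3P[]].
pose Z : {set V} := [set x in flatten pcs].
have cardZ : #|Z| = size (flatten pcs) by rewrite cardsE; apply/card_uniqP.
have vs_Z x : x \in vs -> x \in Z.
  by move=> /Gs_vs h; rewrite inE flat_pcs !mem_cat h orbT.
have vt_Z x : x \in vt -> x \in Z.
  by move=> /Gt_vt h; rewrite inE flat_pcs !mem_cat h !orbT.
have ZA : Ap :&: Z = [set x in vt ++ ve].
  apply/setP => x; rewrite in_setI [in RHS]inE mem_cat.
  apply/andP/orP => [[xA]|[xt|xe]]; last 2 first.
  - by rewrite vtA // vt_Z.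
  - by rewrite veA // vs_Z // mem_cat xe orbT.
  rewrite inE flat_pcs !mem_cat => /or4P[/ps_B|/Gs_sub|/Gt_sub|/Bs_sub].
  - by rewrite AB.
  - case; last by rewrite inE AB // andbF.
    by rewrite mem_cat mem_enum => /orP[/V0N[]|]; [rewrite xA|right].
  - by case; [left|rewrite inE AB // andbF].
  - by rewrite inE AB // andbF.
have cX : #|Ap :\: Z| = 3 * size pcs.
  have cZA : #|Ap :&: Z| = t + e.
    by rewrite ZA cardsE (card_uniqP uvt) size_cat svt sve.
  have := cardsID Z Ap; rewrite cZA size_pcs ApE => /eqP.
  by rewrite eqn_add2l => /eqP.
have cXY : #|Ap :\: Z| + #|Bp :\: Z| + #|Z| = #|V|.
  rewrite -[RHS](cardsC Z) addnC; congr (_ + _).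
  rewrite -[RHS](cardsID Ap) [~: Z :&: Ap]setIC -setDE; congr (_ + _).
  apply: eq_card => x; rewrite !in_setD !in_setC.
  case xZ : (x \in Z) => //=; first by rewrite andbF.
  rewrite andbT; case xA : (x \in Ap) => /=; first by rewrite AB.
  case xB : (x \in Bp) => //.
  have : x \in V0 by rewrite !inE xA xB.
  by move=> x0; move: xZ; rewrite vs_Z // mem_cat mem_enum x0.
have cN : #|~: Bp| = #|V0| + #|Ap|.
  rewrite -(cardsID Ap (~: Bp)) addnC; congr (_ + _); apply: eq_card => x.
    by rewrite !inE negb_or.
  by rewrite !inE; case xA : (x \in Ap); rewrite ?andbF ?andbT ?(AB _ xA).
have KM : K * M + l * M = 3 * (s * d) * M.
  by rewrite -mulnDl /K (conn_sizeE par).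
have card_V' : #|V| = size (flatten pcs) + K * size pcs.
  rewrite size_pcs flat_pcs !size_cat size_ps size_Gs size_Gt size_Bs svs card_V.
  (* Every vertex outside [B'] accounts for [s] edges, except that those in [vt] account for [s.-1]
     each, and the [mP] edges of the given paths contain none of them. Multiplying by [d] turns this
     count of edges into one of vertices. *)
  have h1 : (s * (#|V0| + (t + e + 3 * M)) + mP) * d = (n' + t) * d.
    by rewrite -ApE -cN edges.
  have h2 : t * (s.-1 * d) + t * d = t * (s * d) by rewrite -mulnDr sd1.
  have h3 : M * l = (size ps + #|V0| + t + e + f) * l by rewrite -fM.
  clear -h1 h2 h3 KM; lia.
move=> hc hM hQ.
apply: (hamilton_of_pieces par ok0 ok1 few_nonedges_Ap few_nonedges_ok (pcs := pcs) (c := c)) => //.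
- move=> p; rewrite !mem_cat => /or4P[/ps_piece|/Gs_piece[]|/Gt_piece[]|/Bs_piece[]] //.
- apply/eqP; rewrite -(eqn_add2l (3 * size pcs)) -mulnDl subnKC; last first.
    by clear -k_lt_sd def_k l_ge2; rewrite /conn_size; lia.
  by rewrite -(eqn_add2r (size (flatten pcs))) -cardZ -cX cXY card_V' cardZ addnC.
- rewrite size_pcs -(leq_pmul2l (_ : 0 < 3)) //; apply: leq_trans hc _.
  by rewrite mulnCA leq_mul2l; apply/orP; right; clear -ApE size_pcs e2; lia.
- by rewrite size_pcs; clear -hAp ApE e2; lia.
- apply: leq_trans hQ; rewrite !muln_gt0 !expn_gt0 /=.
  have c0 : 0 < c.
    case: (c) hc => [|//]; rewrite mul0n leqn0 muln_eq0 /= => /eqP V_eq0.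
    have : #|Ap| <= 0 by rewrite -V_eq0; apply: max_card.
    by clear -hAp; lia.
  have k0 : 0 < k by rewrite def_k addn_gt0 (ltnW l_ge2).
  by rewrite c0 k0 (ltnW s_ge2).
- rewrite size_pcs -(leq_pmul2l (_ : 0 < 3)) //; apply: leq_trans hM _.
  by clear -ApE e2; lia.
Qed.

End Assembly.

(** * Degrees in the extremal case *)

Lemma card_prop_pairs_le (S T : finType) (P : {set S}) (G : S -> {set T}) (m : nat) :
  (forall x, x \in P -> #|G x| <= m) ->
  #|[set p : S * T | (p.1 \in P) && (p.2 \in G p.1)]| <= #|P| * m.
Proof.
move=> h.
have sub : [set p : S * T | (p.1 \in P) && (p.2 \in G p.1)]
    \subset \bigcup_(x in P) [set (x, y) | y in G x].
  apply/subsetP => -[x y]; rewrite inE /= => /andP[xP yG].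
  by apply/bigcupP; exists x => //; apply: imset_f.
apply: leq_trans (subset_leq_card sub) _; apply: leq_trans (leq_card_bigcup _ _) _.
rewrite -sum_nat_const; apply: leq_sum => x xP.
exact: leq_trans (leq_imset_card _ _) (h x xP).
Qed.

Lemma card_pairs_sum (S T : finType) (P : {set S}) (G : S -> {set T}) :
  #|[set p : S * T | (p.1 \in P) && (p.2 \in G p.1)]| = \sum_(x in P) #|G x|.
Proof.
rewrite -sum1_card (eq_bigl (fun p : S * T => (p.1 \in P) && (p.2 \in G p.1))).
  rewrite -(pair_big_dep (mem P) (fun x y => y \in G x) (fun _ _ => 1)) /=.
  by apply: eq_bigr => x _; rewrite sum1_card.
by move=> p; rewrite inE.
Qed.

Lemma card_sets_hitting (V : finType) (j : nat) (H : {set V}) :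
  #|[set W : {set V} | (#|W| == j.+1) && (W :&: H != set0)]| <= #|H| * #|V| ^ j.
Proof.
pose pr := [set p : V * {set V} | (p.1 \in H) && (p.2 \in [set W : {set V} | #|W| == j])].
apply: (@leq_trans #|pr|); last first.
  rewrite /pr (card_pairs_sum H (fun _ => [set W : {set V} | #|W| == j])).
  rewrite -sum_nat_const; apply: leq_sum => x _.
  by rewrite card_draws; apply: bin_leq_exp.
apply: leq_trans (leq_imset_card (fun p : V * {set V} => p.1 |: p.2) _).
apply: subset_leq_card; apply/subsetP => W; rewrite inE => /andP[/eqP cW /set0Pn[x]].
rewrite inE => /andP[xW xH]; apply/imsetP; exists (x, W :\ x); last by rewrite /= setD1K.
by rewrite !inE xH /=; have := cardsD1 x W; rewrite xW cW add1n => -[<-].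
Qed.

Section Counting.

Variables (V : finType) (k : nat) (E : {set {set V}}).
Hypothesis kE : kgraph k E.
Variables (A B : {set V}).

Definition link (X Z : {set V}) : {set {set V}} :=
  [set Y : {set V} | [&& Y \subset Z, #|Y| == k - #|X| & X :|: Y \in E]].

(** The left side counts pairs [M], [Y] whose union with [L] is an edge. They are disjoint because
    edges have exactly [k] vertices, so the pair is determined by [M :|: Y], counted in the degree
    of [L], and one of its at most [2 ^ k] subsets. *)
Lemma sum_deg_extensions (L : {set V}) (j : nat) : #|L| + j <= k ->
  \sum_(M in [set M : {set V} | [&& M \subset B, #|M| == j & [disjoint L & M]]])
     deg k E (L :|: M) B <= 2 ^ k * deg k E L B.
Proof.
move=> Lj; set P := [set M : {set V} | _].
rewrite -(card_pairs_sum P (fun M => link (L :|: M) B)).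
set pairs := [set p : _ * _ | _].
have split_pair M Y : (M, Y) \in pairs ->
    [/\ M \subset B, Y \subset B, #|M :|: Y| = k - #|L|, L :|: (M :|: Y) \in E & [disjoint M & Y]].
  rewrite !inE /= => /andP[/and3P[MB /eqP cM dLM] /and3P[YB /eqP cY LMY]].
  have cLM : #|L :|: M| = #|L| + j by rewrite cardsU (disjoint_setI0 dLM) cards0 subn0 cM.
  have := kE LMY => c1.
  have c2 : #|(L :|: M) :|: Y| + #|(L :|: M) :&: Y| = #|L :|: M| + #|Y| by rewrite cardsUI.
  have c3 : #|(L :|: M) :&: Y| = 0 by lia.
  have I0 := cards0_eq c3.
  have dMY : [disjoint M & Y].
    by rewrite -setI_eq0 -subset0 -I0; apply: setSI; apply: subsetUr.
  split=> //; last by rewrite setUA.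
  by rewrite cardsU (disjoint_setI0 dMY) cards0 subn0; lia.
pose F (p : {set V} * {set V}) := (p.1 :|: p.2, p.1).
have F_inj : {in pairs &, injective F}.
  move=> [M Y] [M' Y'] /split_pair[_ _ _ _ d1] /split_pair[_ _ _ _ d2] [e1 e2].
  move: d1 d2 e1; rewrite -{}e2 => d1 d2 e1; congr (_, _).
  have h (Z : {set V}) : [disjoint M & Z] -> (M :|: Z) :\: M = Z.
    move=> d; rewrite setDUl setDv set0U; apply/setDidPl.
    by rewrite disjoint_sym.
  by rewrite -(h Y) // e1 h.
rewrite -(card_in_imset F_inj).
have -> : deg k E L B = #|link L B| by [].
rewrite mulnC.
pose pairs' := [set p : {set V} * {set V} | (p.1 \in link L B) && (p.2 \in powerset p.1)].
apply: (@leq_trans #|pairs'|).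
  apply: subset_leq_card; apply/subsetP => _ /imsetP[[M Y] /split_pair[MB YB cMY EMY _] ->].
  by rewrite !inE /= subUset MB YB cMY eqxx EMY subsetUl.
apply: card_prop_pairs_le => Z; rewrite inE => /and3P[_ /eqP cZ _].
by rewrite card_powerset leq_exp2l // cZ leq_subr.
Qed.

Hypothesis k_gt0 : 0 < k.
Hypothesis AB_T : A :|: B = [set: V].
Hypothesis codeg_ge : forall S : {set V}, #|S| = k.-1 -> #|A| <= codeg E S.

(* Since S has at least |A| neighbours in all, it has at most as many
   non-neighbours in A as neighbours in B. *)
Lemma nonneighbours_le_deg (S : {set V}) : #|S| = k.-1 ->
  #|[set x in A | (x \notin S) && (x |: S \notin E)]| <= deg k E S B.
Proof.
move=> cS.
pose NB := [set x | (x \notin S) && (x |: S \in E)].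
have h1 : #|NB :&: B| <= deg k E S B.
  rewrite -(card_imset _ (@set1_inj V)); apply: subset_leq_card.
  apply/subsetP => _ /imsetP[x xNB ->]; move: xNB; rewrite !inE => /andP[/andP[xS xE] xB].
  by rewrite sub1set xB cards1 cS setUC xE andbT; apply/eqP; lia.
apply: leq_trans h1; rewrite -(leq_add2l #|NB :&: A|).
have h2 : #|NB| <= #|NB :&: A| + #|NB :&: B|.
  by rewrite -[NB in X in X <= _]setIT -AB_T setIUr cardsU leq_subr.
apply: leq_trans h2; apply: leq_trans (codeg_ge cS).
rewrite -(cardsID NB A) [NB :&: A]setIC leq_add2l; apply: subset_leq_card.
by apply/subsetP => x; rewrite !inE => /andP[-> /andP[-> /negbTE ->]].
Qed.

(** For fixed [p.1], [nonneighbours_le_deg] bounds the choices of [p.2] by the degree of [L :|: p.1]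
    in [B], and [sum_deg_extensions] adds these up. Thus a set of small degree in [B] has few
    non-edges through [A]. *)
Lemma nonedges_through_A (L : {set V}) (j : nat) : #|L| + j = k.-1 ->
  #|[set p : {set V} * V | [&& p.1 \subset B, #|p.1| == j, [disjoint L & p.1],
       p.2 \in A, p.2 \notin L :|: p.1 & p.2 |: (L :|: p.1) \notin E]]|
    <= 2 ^ k * deg k E L B.
Proof.
move=> Lj; set P := [set M : {set V} | [&& M \subset B, #|M| == j & [disjoint L & M]]].
apply: leq_trans (@sum_deg_extensions L j _); last by lia.
pose G (M : {set V}) := [set x in A | (x \notin L :|: M) && (x |: (L :|: M) \notin E)].
apply: (@leq_trans (\sum_(M in P) #|G M|)).
  rewrite -card_pairs_sum; apply: subset_leq_card; apply/subsetP => -[M x].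
  by rewrite !inE /= => /and5P[-> -> -> -> h].
apply: leq_sum => M; rewrite inE => /and3P[_ /eqP cM dLM].
apply: nonneighbours_le_deg.
by rewrite cardsU (disjoint_setI0 dLM) cards0 subn0 cM.
Qed.

End Counting.

(** The induction step rests on [j * m.+1 <= j.+1 * m]. *)
Lemma exp_leq_bin (m j : nat) : j <= m -> m ^ j <= j ^ j * 'C(m, j).
Proof.
elim: j m => [|j IH] [|m] // jm.
have -> : j.+1 ^ j.+1 * 'C(m.+1, j.+1) = m.+1 * (j.+1 ^ j * 'C(m, j)).
  by rewrite expnSr -mulnA -mul_bin_diag mulnCA.
rewrite expnS leq_mul2l /=.
have h := IH m jm.
have [->|j0] := posnP j; first by rewrite !expn0 bin0.
rewrite -(leq_pmul2l (_ : 0 < j ^ j)); last by rewrite expn_gt0 j0.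
rewrite mulnCA; apply: (@leq_trans (j.+1 ^ j * m ^ j)); last first.
  by rewrite leq_mul2l h orbT.
by rewrite -!expnMn leq_exp2r // mulnS mulSn; lia.
Qed.

(** * Estimates in terms of the parameter [e] *)

Section Estimates.

Variables (R : realType) (V : finType) (k l : nat) (E : {set {set V}}).
Hypothesis kE : kgraph k E.
Variables (A B : {set V}) (e : R).
Hypotheses (AB_T : A :|: B = [set: V]) (AB_0 : A :&: B = set0).
Hypothesis codeg_ge : forall S : {set V}, #|S| = k.-1 -> #|A| <= codeg E S.
Hypotheses (k_gt2 : 2 < k) (l_gt0 : 0 < l) (lk : l.+2 <= k).

Let k1_gt0 : 0 < k.-1. Proof. by clear -k_gt2; lia. Qed.
Let k2 : k.-2.+1 = k.-1. Proof. by clear -k_gt2; lia. Qed.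
Let n := #|V|.
(** [Cb] compares powers of [n] with binomial coefficients of [#|B|], and [C0 * e ^+ 3] will bound
    the proportions of bad sets and of atypical vertices, the latter counted by [r]. *)
Let Cb := (2 * k) ^ k.
Let C0 : R := (Cb * 2 ^ k)%:R.
Let Ap := A' k E e B.
Let Bp := B' k E e B.
Let ok : pred {set V} := good k E e B.
Let r := #|A :\: Ap| + #|B :\: Bp|.

Hypothesis n_gt0 : 0 < n.
Hypothesis bin_ge : forall j, j <= k -> n ^ j <= Cb * 'C(#|B|, j).
Hypothesis few_edges : ((nedges E B)%:R <= e ^+ 4 * n%:R ^+ k)%R.
Hypotheses (e_gt0 : (0 < e)%R) (e_lt : (e < 1 / 2%:R)%R) (e_lt1 : (C0 * e ^+ 3 < 1)%R).

Let nR_gt0 : (0 < n%:R :> R)%R. Proof. by rewrite ltr0n. Qed.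
Let Cb_gt0 : 0 < Cb. Proof. by rewrite expn_gt0 muln_gt0 (ltn_trans _ k_gt2). Qed.
Let C0_gt0 : (0 < C0)%R. Proof. by rewrite ltr0n muln_gt0 Cb_gt0 expn_gt0. Qed.

(** A Markov bound: [b] objects, each of weight at least [e] times a full degree, against a total of
    [2 ^ k * nedges E B]. One of the four factors [e] in [few_edges] pays for the division. *)
Let cancel_bin (b j : nat) : j <= k ->
  (b%:R * (e * 'C(#|B|, k - j)%:R) <= (2 ^ k * nedges E B)%:R)%R ->
  (b%:R <= C0 * e ^+ 3 * n%:R ^+ j)%R.
Proof.
move=> jk h.
have h1 : ((n ^ (k - j))%:R <= (Cb * 'C(#|B|, k - j))%:R :> R)%R.
  by rewrite ler_nat bin_ge // leq_subr.
have P0 : (0 < e * n%:R ^+ (k - j))%R by rewrite mulr_gt0 // exprn_gt0.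
rewrite -(ler_pM2r P0).
apply: (@le_trans _ _ (Cb%:R * (b%:R * (e * 'C(#|B|, k - j)%:R)))%R).
  rewrite [(Cb%:R * (b%:R * _))%R]mulrCA [(Cb%:R * (e * _))%R]mulrCA.
  by rewrite ler_wpM2l // ler_wpM2l ?(ltW e_gt0) // -natrX -natrM.
apply: (@le_trans _ _ (Cb%:R * (2 ^ k * nedges E B)%:R)%R); first by rewrite ler_wpM2l.
rewrite natrM mulrA -natrM.
apply: (@le_trans _ _ (C0 * (e ^+ 4 * n%:R ^+ k))%R).
  by rewrite ler_wpM2l // ltW.
rewrite -[in leLHS](subnK jk) exprD exprSr.
by rewrite le_eqVlt; apply/orP; left; apply/eqP; ring.
Qed.

Let disjoint_set0 (M : {set V}) : [disjoint set0 & M].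
Proof. by rewrite -setI_eq0 set0I. Qed.

Let deg0_le : deg k E set0 B <= nedges E B.
Proof.
apply: subset_leq_card; apply/subsetP => Y; rewrite !inE set0U.
by case/and3P=> -> _ ->.
Qed.

Let bad_sets j := [set L : {set V} | [&& L \subset B, #|L| == j & bad k E e B L]].

Lemma card_bad_sets j : j <= k -> (#|bad_sets j|%:R <= C0 * e ^+ 3 * n%:R ^+ j)%R.
Proof.
move=> jk; apply: cancel_bin => //.
apply: (@le_trans _ _ (\sum_(L in bad_sets j) deg k E L B)%:R%R); last first.
  rewrite ler_nat.
  apply: (@leq_trans (2 ^ k * deg k E set0 B)); last by rewrite leq_mul2l deg0_le orbT.
  apply: leq_trans (sum_deg_extensions kE B (L := set0) (j := j) _); last by rewrite cards0.
  rewrite [leqRHS](eq_bigr (fun M => deg k E M B)); last by move=> M _; rewrite set0U.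
  rewrite [leqLHS]big_mkcond [leqRHS]big_mkcond; apply: leq_sum => M _.
  by rewrite !inE; case: and3P => // -[-> -> _]; rewrite disjoint_set0.
rewrite natr_sum mulr_natl -sumr_const; apply: ler_sum => L.
by rewrite inE => /and3P[_ /eqP <- /ltW].
Qed.

Lemma card_B_minus : (#|B :\: Bp|%:R <= C0 * e ^+ 3 * n%:R)%R.
Proof.
have := @card_bad_sets 1 (ltnW (ltnW k_gt2)); rewrite expr1; apply: le_trans.
rewrite ler_nat -(card_imset _ (@set1_inj V)); apply: subset_leq_card.
apply/subsetP => _ /imsetP[x + ->]; rewrite !inE -ltNge => /andP[h xB].
by rewrite sub1set xB cards1 /bad cards1 subn1.
Qed.

(** A vertex of [A] outside [A'] lies in more than [e * 'C(#|B|, k.-1)] non-edges whose other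
    vertices are in [B]. With [L] empty, [nonedges_through_A] bounds all of these by
    [2 ^ k * nedges E B]. *)
Lemma card_A_minus : (#|A :\: Ap|%:R <= C0 * e ^+ 3 * n%:R)%R.
Proof.
rewrite -[(n%:R)%R]expr1; apply: cancel_bin; first exact: ltnW (ltnW k_gt2).
pose N x := [set W : {set V} | [&& W \subset B, #|W| == k.-1 & x |: W \notin E]].
have xB x : x \in A :\: Ap -> x \notin B.
  rewrite inE => /andP[_ xA]; apply/negP => xB.
  by have : x \in A :&: B; [rewrite inE xA xB|rewrite AB_0 inE].
apply: (@le_trans _ _ (\sum_(x in A :\: Ap) #|N x|)%:R%R); last first.
  rewrite ler_nat -card_pairs_sum.
  apply: (@leq_trans (2 ^ k * deg k E set0 B)); last by rewrite leq_mul2l deg0_le orbT.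
  apply: leq_trans (nonedges_through_A kE _ AB_T codeg_ge (L := set0) (j := k.-1) _).
  - pose F (p : V * {set V}) := (p.2, p.1).
    have F_inj : injective F by move=> [a b] [a' b'] [-> ->].
    rewrite -(card_imset _ F_inj); apply: subset_leq_card.
    apply/subsetP => _ /imsetP[[x W] + ->]; rewrite inE /= => /andP[xA].
    have xBn := xB x xA; have xAA : x \in A by move: xA; rewrite inE => /andP[].
    rewrite !inE /= => /and3P[WB -> WE].
    rewrite WB disjoint_set0 xAA !set0U WE andbT /=.
    by apply: contra xBn; apply: (subsetP WB).
  - exact: ltn_trans k_gt2.
  - by rewrite cards0.
rewrite natr_sum mulr_natl -sumr_const; apply: ler_sum => x.
rewrite inE => /andP[xA _].
have dN : 'C(#|B|, k.-1) <= deg k E [set x] B + #|N x|.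
  rewrite -cards_draws; apply: (leq_trans _ (leq_card_setU _ _)).
  apply: subset_leq_card; apply/subsetP => W.
  rewrite !inE => /andP[-> /eqP ->]; rewrite cards1 subn1 eqxx /=.
  by case: (_ \in E).
move: xA; rewrite inE -ltNge => xA.
have : ('C(#|B|, k.-1)%:R <= (deg k E [set x] B)%:R + #|N x|%:R :> R)%R.
  by rewrite -natrD ler_nat.
rewrite subn1; move: xA; rewrite mulrBl mul1r; lra.
Qed.

Lemma disjoint_ApBp : [disjoint Ap & Bp].
Proof.
apply/pred0P => x /=; apply/negbTE/negP; rewrite !inE => /andP[h1 h2].
have c0 : (0 < 'C(#|B|, k.-1)%:R :> R)%R.
  rewrite ltr0n; have := bin_ge (leq_pred k); case: 'C(_, _) => //.
  by rewrite muln0 leqn0 expn_eq0; move: n_gt0; rewrite lt0n => /negbTE ->.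
by have := le_trans h1 h2; rewrite ler_pM2r //; move: e_lt; lra.
Qed.

Lemma Ap_minus_A : Ap :\: A \subset B :\: Bp.
Proof.
apply/subsetP => x; rewrite in_setD => /andP[xA xAp].
rewrite in_setD (disjointFr disjoint_ApBp xAp) /=.
by have := in_setT x; rewrite -AB_T inE (negbTE xA).
Qed.

Lemma Bp_minus_B : Bp :\: B \subset A :\: Ap.
Proof.
apply/subsetP => x; rewrite in_setD => /andP[xB xBp].
rewrite in_setD (disjointFl disjoint_ApBp xBp) /=.
by have := in_setT x; rewrite -AB_T inE (negbTE xB) orbF.
Qed.

(** Three kinds of non-edges occur. If [x] is in [A] and the rest of [W] in [B],
    [nonedges_through_A] counts them. Otherwise [x] is in [B :\: Bp], or the rest of [W] meets
    [A :\: Ap], and the set is charged to one of the [r] atypical vertices. *)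
Lemma card_nonedges_ok (L : {set V}) : #|L| <= l ->
  #|[set W : {set V} | [&& #|W| == k - #|L|, [disjoint L & W],
       [exists x in W, (x \in Ap) && (W :\ x \subset Bp)] & L :|: W \notin E]]|
  <= 2 ^ k * deg k E L B + r * n ^ (k.-1 - #|L|).
Proof.
move=> Ll; have [j jE] : exists j, k.-1 - #|L| = j.+1.
  by exists (k.-1 - #|L|).-1; clear -Ll lk; lia.
pose P1 := [set p : {set V} * V | [&& p.1 \subset B, #|p.1| == j.+1, [disjoint L & p.1],
       p.2 \in A, p.2 \notin L :|: p.1 & p.2 |: (L :|: p.1) \notin E]].
pose P2 := [set p : V * {set V} | (p.1 \in B :\: Bp) && (p.2 \in [set M : {set V} | #|M| == j.+1])].
pose P3 := [set p : {set V} * V | (p.1 \in [set M : {set V} |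
    (#|M| == j.+1) && (M :&: (A :\: Ap) != set0)]) && (p.2 \in [set: V])].
have c1 : #|P1| <= 2 ^ k * deg k E L B.
  have kL : #|L| + j.+1 = k.-1 by clear -jE Ll lk; lia.
  by apply: nonedges_through_A => //; clear -k_gt2; lia.
have c2 : #|P2| <= #|B :\: Bp| * n ^ j.+1.
  apply: (card_prop_pairs_le (G := fun _ => [set M : {set V} | #|M| == j.+1])) => x _.
  by rewrite card_draws; apply: bin_leq_exp.
have c3 : #|P3| <= #|A :\: Ap| * n ^ j.+1.
  apply: leq_trans (card_prop_pairs_le (G := fun _ => [set: V]) (m := n) _) _.
    by move=> x _; rewrite cardsT.
  by rewrite expnSr mulnA leq_mul2r card_sets_hitting orbT.
rewrite jE; apply: (@leq_trans (#|P1| + (#|P2| + #|P3|))); last first.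
  by apply: leq_add => //; rewrite /r mulnDl addnC leq_add.
pose F (p : {set V} * V) := p.2 |: p.1.
pose F' (p : V * {set V}) := p.1 |: p.2.
apply: (@leq_trans #|F @: P1 :|: (F' @: P2 :|: F @: P3)|); last first.
  apply: leq_trans (leq_card_setU _ _) (leq_add (leq_imset_card _ _) _).
  exact: leq_trans (leq_card_setU _ _) (leq_add (leq_imset_card _ _) (leq_imset_card _ _)).
apply: subset_leq_card; apply/subsetP => W; rewrite inE => /and4P[/eqP cW dLW].
case/exists_inP => x xW /andP[xAp WxB] nE.
have cWx : #|W :\ x| = j.+1.
  have h := cardsD1 x W; rewrite xW cW in h.
  by clear -h jE Ll lk; lia.
have WE : W = x |: (W :\ x) by rewrite setD1K.
rewrite in_setU in_setU; have [xA|xA] := boolP (x \in A); last first.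
  apply/orP; right; apply/orP; left; apply/imsetP; exists (x, W :\ x) => //.
  have xBn : x \in B :\: Bp by apply: (subsetP Ap_minus_A); rewrite in_setD xA.
  by rewrite in_set /= xBn in_set cWx eqxx.
have [WB|WB] := boolP (W :\ x \subset B).
  apply/orP; left; apply/imsetP; exists (W :\ x, x) => //.
  have xL : x \notin L by rewrite (disjointFl dLW xW).
  have dL : [disjoint L & W :\ x].
    by rewrite disjoint_sym (disjointWl (subsetDl _ _)) // disjoint_sym.
  rewrite inE /= WB cWx eqxx dL xA in_setU negb_or xL in_setD1 eqxx /=.
  by rewrite setUCA -WE.
apply/orP; right; apply/orP; right; apply/imsetP; exists (W :\ x, x) => //.
rewrite !inE /= cWx eqxx andbT /=; case/subsetPn: WB => y yW yB.
apply/set0Pn; exists y; rewrite in_setI yW /=; apply: (subsetP Bp_minus_B).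
by rewrite in_setD yB (subsetP WxB).
Qed.

Lemma card_nonedges_Ap x : x \in Ap ->
  (#|[set W : {set V} | [&& #|W| == k.-1, W \subset Bp & x |: W \notin E]]|%:R
    <= e * n%:R ^+ k.-1 + (r * n ^ k.-2)%:R)%R.
Proof.
move=> xA; set F := [set W : {set V} | _].
pose N := [set W : {set V} | [&& W \subset B, #|W| == k.-1 & x |: W \notin E]].
pose H := [set W : {set V} | (#|W| == k.-2.+1) && (W :&: (A :\: Ap) != set0)].
have FN : #|F| <= #|N| + #|H|.
  apply: (leq_trans _ (leq_card_setU _ _)); apply: subset_leq_card; apply/subsetP => W.
  rewrite !inE k2 => /and3P[-> WBp ->]; rewrite /= !andbT.
  have [//|/subsetPn[y yW yB]] := boolP (W \subset B); apply/set0Pn; exists y.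
  by rewrite in_setI yW /=; apply: (subsetP Bp_minus_B); rewrite in_setD yB (subsetP WBp).
have hH : #|H| <= r * n ^ k.-2.
  apply: leq_trans (card_sets_hitting _ _) _.
  by rewrite leq_mul2r leq_addr orbT.
have dN : deg k E [set x] B + #|N| <= 'C(#|B|, k.-1).
  rewrite -cards_draws -cardsUI [X in _ + X](_ : _ = 0) ?addn0; last first.
    apply/eqP; rewrite cards_eq0; apply/eqP/setP => W; rewrite !inE.
    by case: (_ \in E); rewrite ?andbF.
  apply: subset_leq_card; apply/subsetP => W; rewrite !inE cards1 subn1.
  by case/orP => /and3P[-> -> _].
have hN : (#|N|%:R <= e * 'C(#|B|, k.-1)%:R :> R)%R.
  have : ((deg k E [set x] B)%:R + #|N|%:R <= 'C(#|B|, k.-1)%:R :> R)%R.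
    by rewrite -natrD ler_nat.
  by move: xA; rewrite inE mulrBl mul1r; lra.
have hB : ('C(#|B|, k.-1)%:R <= n%:R ^+ k.-1 :> R)%R.
  rewrite -natrX ler_nat; apply: leq_trans (bin_leq_exp _ _) _.
  by rewrite leq_exp2r ?max_card.
have : (#|F|%:R <= #|N|%:R + #|H|%:R :> R)%R by rewrite -natrD ler_nat.
have : (#|H|%:R <= (r * n ^ k.-2)%:R :> R)%R by rewrite ler_nat.
have : (e * 'C(#|B|, k.-1)%:R <= e * n%:R ^+ k.-1 :> R)%R by rewrite ler_pM2l.
lra.
Qed.

Definition unclean : {set {set V}} :=
  [set W : {set V} | [&& W \subset B, #|W| == k.-1
     & [exists L : {set V}, [&& L \subset W, #|L| <= l & bad k E e B L]]]].

Lemma cleanP (W : {set V}) : W \subset B -> #|W| = k.-1 -> W \notin unclean -> clean l ok W.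
Proof.
move=> WB cW; rewrite inE WB cW eqxx /= negb_exists => /forallP h L LW cL.
by have := h L; rewrite LW cL.
Qed.

(** A bad [j]-set extends to at most [n ^ (k.-1 - j)] sets of size [k.-1], so each of the [l.+1]
    sizes contributes at most [C0 * e ^+ 3 * n%:R ^+ k.-1]. *)
Lemma card_unclean : (#|unclean|%:R <= l.+1%:R * (C0 * e ^+ 3) * n%:R ^+ k.-1)%R.
Proof.
pose P (j : 'I_l.+1) := [set p : {set V} * {set V} |
  (p.1 \in bad_sets j) && (p.2 \in [set M : {set V} | #|M| == k.-1 - j])].
have h1 : #|unclean| <= \sum_(j < l.+1) #|bad_sets j| * n ^ (k.-1 - j).
  apply: (@leq_trans #|\bigcup_(j < l.+1) [set p.1 :|: p.2 | p in P j]|).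
    apply: subset_leq_card; apply/subsetP => W; rewrite inE => /and3P[WB /eqP cW].
    case/existsP => L /and3P[LW Ll bL]; apply/bigcupP.
    exists (Ordinal (Ll : #|L| < l.+1)) => //; apply/imsetP; exists (L, W :\: L) => /=.
      by rewrite !inE /= (subset_trans LW WB) eqxx bL cardsD (setIidPr LW) cW eqxx.
    by rewrite -[LHS](setID W L) (setIidPr LW).
  apply: leq_trans (leq_card_bigcup _ _) _; apply: leq_sum => j _.
  apply: leq_trans (leq_imset_card _ _) _.
  apply: (card_prop_pairs_le (G := fun _ => [set M : {set V} | #|M| == k.-1 - j])) => L _.
  by rewrite card_draws; apply: bin_leq_exp.
apply: (@le_trans _ _ (\sum_(j < l.+1) (C0 * e ^+ 3 * n%:R ^+ k.-1))%R); last first.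
  by rewrite sumr_const card_ord -[leRHS]mulrA mulr_natl.
apply: (@le_trans _ _ (\sum_(j < l.+1) #|bad_sets j| * n ^ (k.-1 - j))%:R%R).
  by rewrite ler_nat.
rewrite natr_sum; apply: ler_sum => j _.
have jk : j <= k.-1 by have := ltn_ord j; clear -lk; lia.
rewrite natrM natrX -{2}(subnKC jk) exprD mulrA ler_wpM2r ?exprn_ge0 //.
by apply: card_bad_sets; apply: leq_trans jk (leq_pred _).
Qed.

(** The number of bad sets of size 0 is at most [C0 * e ^+ 3 < 1], hence 0. *)
Lemma ok_set0 : ok set0.
Proof.
have := @card_bad_sets 0 (leq0n _); rewrite expr0 mulr1 => /le_lt_trans /(_ e_lt1).
rewrite -[1%R]/(1%:R)%R ltr_nat ltnS leqn0 cards_eq0 => /eqP h.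
apply/negP => b0; have : set0 \in bad_sets 0 by rewrite inE sub0set cards0 eqxx b0.
by rewrite h inE.
Qed.

Lemma ok_set1 u : u \in Bp -> ok [set u].
Proof. by rewrite /ok /good /bad inE -leNgt cards1 subn1. Qed.

(** Of the more than [e * 'C(#|B|, k.-1)] link sets of [v] in [B], those discarded meet [U] (the
    term [cap]), meet [B :\: Bp] (one term [C0 * e ^+ 3]) or are unclean ([l.+1] such terms). The
    term [(2 * k)%:R] is the surplus required. *)
Lemma available_links (cap : nat) :
  (Cb%:R * ((2 * k)%:R + cap%:R + l.+2%:R * (C0 * e ^+ 3) * n%:R) <= e * n%:R)%R ->
  forall (v : V) (U : {set V}), v \notin Bp -> #|U| <= cap ->
  exists F : {set {set V}},
    (forall W, W \in F ->
       [/\ #|W| = k.-1, W \subset Bp :\: U, clean l ok W & v |: W \in E])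
    /\ 2 * k * n ^ k.-2 < #|F|.
Proof.
move=> hcap v U vB cU.
pose D := link k E [set v] B.
pose H1 := [set W : {set V} | (#|W| == k.-2.+1) && (W :&: U != set0)].
pose H2 := [set W : {set V} | (#|W| == k.-2.+1) && (W :&: (B :\: Bp) != set0)].
exists (D :\: (H1 :|: (H2 :|: unclean))); split.
  move=> W; rewrite in_setD !in_setU !negb_or => /andP[/and3P[h1 h2 h3]].
  rewrite inE cards1 subn1 => /and3P[WB /eqP cW vW]; split=> //; last first.
    exact: cleanP.
  move: h1 h2; rewrite !inE k2 cW eqxx /= !negbK !setI_eq0 => dU dB.
  rewrite subsetD dU andbT; apply/subsetP => x xW.
  apply: contraTT xW => xB; apply/negP => xW.
  have := disjointFr dB xW; rewrite in_setD xB (subsetP WB) //.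
have c1 : #|H1| <= cap * n ^ k.-2.
  by apply: leq_trans (card_sets_hitting _ _) _; rewrite leq_mul2r cU orbT.
have c2 : (#|H2|%:R <= C0 * e ^+ 3 * n%:R * n%:R ^+ k.-2 :> R)%R.
  apply: (@le_trans _ _ (#|B :\: Bp| * n ^ k.-2)%:R%R).
    by rewrite ler_nat card_sets_hitting.
  by rewrite natrM natrX ler_wpM2r ?exprn_ge0 // card_B_minus.
have c3 := card_unclean.
have cD : (e * 'C(#|B|, k.-1)%:R < #|D|%:R :> R)%R by move: vB; rewrite inE -ltNge.
have cF : #|D| <= #|D :\: (H1 :|: (H2 :|: unclean))| + (#|H1| + (#|H2| + #|unclean|)).
  rewrite -(cardsID (H1 :|: (H2 :|: unclean)) D) addnC leq_add2l.
  apply: leq_trans (subset_leq_card (subsetIr _ _)) _.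
  apply: leq_trans (leq_card_setU _ _) _; rewrite leq_add2l; exact: leq_card_setU.
have nn : (n%:R ^+ k.-1 = n%:R * n%:R ^+ k.-2 :> R)%R by rewrite -exprS k2.
have P0 : (0 < n%:R ^+ k.-2 :> R)%R by rewrite exprn_gt0.
have hb : (n%:R ^+ k.-1 <= Cb%:R * 'C(#|B|, k.-1)%:R :> R)%R.
  by rewrite -natrX -natrM ler_nat bin_ge // leq_pred.
have h0 : (((2 * k)%:R + cap%:R + l.+2%:R * (C0 * e ^+ 3) * n%:R) * n%:R ^+ k.-2
    <= e * 'C(#|B|, k.-1)%:R)%R.
  rewrite -(ler_pM2l (_ : 0 < Cb%:R)%R) ?ltr0n // [(Cb%:R * (_ * n%:R ^+ _))%R]mulrA.
  apply: (@le_trans _ _ (e * n%:R ^+ k.-1)%R).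
    by rewrite nn [(e * (_ * _))%R]mulrA ler_wpM2r // ltW.
  by rewrite [(Cb%:R * _)%R]mulrCA ler_wpM2l // ltW.
rewrite -(ltr_nat R).
have cFR : (#|D|%:R <= #|D :\: (H1 :|: (H2 :|: unclean))|%:R
    + (#|H1|%:R + (#|H2|%:R + #|unclean|%:R)) :> R)%R.
  by rewrite -!natrD ler_nat.
have c1R : (#|H1|%:R <= cap%:R * n%:R ^+ k.-2 :> R)%R by rewrite -natrX -natrM ler_nat.
rewrite natrM natrX.
move: c1R c2 c3 cD cFR h0; rewrite nn.
set p := (n%:R ^+ k.-2)%R; set f := (#|_ :\: _|%:R)%R.
rewrite -[l.+2]addn1 [((_ + 1)%:R)%R]natrD.
set w := (C0 * e ^+ 3)%R; set L1 := (l.+1%:R)%R; set K2 := ((2 * k)%:R)%R.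
move=> c1R c2 c3 cD cFR.
have -> : ((K2 + cap%:R + (L1 + 1) * w * n%:R) * p =
  K2 * p + cap%:R * p + L1 * w * (n%:R * p) + w * n%:R * p)%R by ring.
lra.
Qed.

Lemma available_clean (bare_cap : nat) :
  n <= 8 * (#|B| - #|B :\: Bp| - bare_cap) -> 8 * k <= n ->
  (((8 * k) ^ k)%:R * (l.+1%:R * (C0 * e ^+ 3)) < 1)%R ->
  forall U : {set V}, #|U| <= bare_cap ->
  exists W : {set V}, [/\ #|W| = l, W \subset Bp :\: U & clean l ok W].
Proof.
move=> hn nk he U cU.
pose T := (B :&: Bp) :\: U.
have cT : #|B| - #|B :\: Bp| - bare_cap <= #|T|.
  have h1 := cardsID Bp B; have h2 := cardsID U (B :&: Bp).
  have h3 := subset_leq_card (subsetIr (B :&: Bp) U).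
  by rewrite -/T in h2; clear -h1 h2 h3 cU; lia.
have nT : n <= 8 * #|T| by apply: leq_trans hn _; rewrite leq_mul2l cT orbT.
have kT : k.-1 <= #|T| by clear -nT nk; lia.
pose D := [set W : {set V} | W \subset T & #|W| == k.-1].
have cD : n ^ k.-1 <= (8 * k) ^ k * #|D|.
  rewrite cards_draws; apply: (@leq_trans ((8 * #|T|) ^ k.-1)).
    by rewrite leq_exp2r //.
  rewrite expnMn; apply: (@leq_trans (8 ^ k.-1 * (k.-1 ^ k.-1 * 'C(#|T|, k.-1)))).
    by rewrite leq_mul2l exp_leq_bin ?orbT.
  rewrite mulnA leq_mul2r -expnMn; apply/orP; right.
  have k0 : 0 < k by exact: ltn_trans k_gt2.
  apply: (@leq_trans ((8 * k) ^ k.-1)).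
    by rewrite leq_exp2r ?leq_mul2l ?leq_pred ?orbT // .
  by rewrite leq_exp2l ?leq_pred // (leq_trans (ltnW k_gt2)) // leq_pmull.
have [W WD Wc] : exists2 W, W \in D & W \notin unclean.
  apply/subsetPn; apply/negP => /subset_leq_card; rewrite -(ler_nat R) => hD.
  have hc := card_unclean.
  have P0 : (0 < n%:R ^+ k.-1 :> R)%R by rewrite exprn_gt0.
  have cDR : (n%:R ^+ k.-1 <= ((8 * k) ^ k)%:R * #|D|%:R :> R)%R.
    by rewrite -natrX -natrM ler_nat.
  have := le_trans cDR (ler_wpM2l (ler0n _ _) (le_trans hD hc)).
  by rewrite [(_ * (_ * n%:R ^+ _))%R]mulrA -[leLHS]mul1r ler_pM2r // leNgt he.
move: WD; rewrite inE => /andP[WT /eqP cW].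
have WB : W \subset B.
  by apply: subset_trans WT _; rewrite /T setIC subDset subsetU // subsetIr orbT.
have clW := cleanP WB cW Wc.
have lW : l <= size (enum W) by rewrite -cardE cW; clear -lk; lia.
have sub : [set x in take l (enum W)] \subset W.
  by apply/subsetP => x; rewrite inE => /mem_take; rewrite mem_enum.
exists [set x in take l (enum W)]; split.
- by rewrite cardsE (card_uniqP _) ?take_uniq ?enum_uniq // size_takel.
- apply: subset_trans sub _; apply: subset_trans WT _.
  by apply: setSD; apply: subsetIr.
- by move=> L LW; apply: clW; apply: subset_trans sub.
Qed.

Lemma card_minus_le : (r%:R <= 2%:R * (C0 * e ^+ 3) * n%:R :> R)%R.
Proof.
have := card_A_minus; have := card_B_minus; rewrite /r natrD.
by set x := (C0 * _ * _)%R; rewrite -mulrA -/x; lra.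
Qed.

Variable Q : nat.
Hypothesis Q_small : (Q%:R * ((2 ^ k)%:R * e + 2%:R * (C0 * e ^+ 3)) <= 1)%R.

Let Q_cancel (m j : nat) :
  (m%:R <= (2 ^ k)%:R * e * n%:R ^+ j.+1 + (r * n ^ j)%:R :> R)%R -> Q * m <= n ^ j.+1.
Proof.
move=> h; rewrite -(ler_nat R) natrM natrX.
have P0 : (0 < n%:R ^+ j.+1 :> R)%R by rewrite exprn_gt0.
have rn : ((r * n ^ j)%:R <= 2%:R * (C0 * e ^+ 3) * n%:R ^+ j.+1 :> R)%R.
  rewrite natrM natrX [(n%:R ^+ j.+1)%R]exprS [(_ * (n%:R * _))%R]mulrA.
  by rewrite ler_wpM2r ?exprn_ge0 // card_minus_le.
apply: (@le_trans _ _ (Q%:R * ((2 ^ k)%:R * e + 2%:R * (C0 * e ^+ 3)) * n%:R ^+ j.+1)%R).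
  by rewrite -mulrA ler_wpM2l // mulrDl (le_trans h) // lerD2l.
by rewrite -[leRHS]mul1r ler_pM2r.
Qed.

Lemma few_nonedges_Ap x : x \in Ap ->
  Q * #|[set W : {set V} | [&& #|W| == k.-1, W \subset Bp & x |: W \notin E]]| <= n ^ k.-1.
Proof.
move=> /card_nonedges_Ap; rewrite -k2 => h; apply: Q_cancel; apply: le_trans h _.
rewrite lerD2r ler_wpM2r ?exprn_ge0 // ler_peMl ?(ltW e_gt0) //.
by rewrite ler1n expn_gt0.
Qed.

Lemma few_nonedges_ok (L : {set V}) : ok L -> #|L| <= l ->
  Q * #|[set W : {set V} | [&& #|W| == k - #|L|, [disjoint L & W],
       [exists x in W, (x \in Ap) && (W :\ x \subset Bp)] & L :|: W \notin E]]|
  <= n ^ (k - #|L|).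
Proof.
move=> okL Ll; have h := card_nonedges_ok Ll.
have kL : k - #|L| = (k.-1 - #|L|).+1 by clear -Ll lk; lia.
rewrite [X in _ ^ X]kL; apply: Q_cancel.
apply: (@le_trans _ _ (2 ^ k * deg k E L B + r * n ^ (k.-1 - #|L|))%:R%R).
  by rewrite ler_nat.
rewrite natrD lerD2r natrM -mulrA ler_wpM2l //.
move: okL; rewrite /ok /good /bad -leNgt => /le_trans; apply.
rewrite ler_wpM2l ?(ltW e_gt0) // -natrX ler_nat -kL.
apply: leq_trans (bin_leq_exp _ _) _.
by rewrite kL leq_exp2r // max_card.
Qed.

End Estimates.

(** * The theorem *)

(** Here [a], [b], [aP], [nB], [v0] are the sizes of [A], [B], [A'], the complement of [B'] and
    [V_0]; [rA] and [rB] count the atypical vertices of [A] and [B]; the given paths number [np],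
    with [mP] edges and [sz] vertices. The subtraction in [t] does not truncate:
    [n' <= s * a <= s * nB + s * q], and the [s * q] given paths have at least one edge each. Also
    [t] is at most a constant times [rA + rB + 1], which is small against [a]. *)
Lemma assembly_numerics (k l s d n n' a b aP rA rB q nB v0 np mP sz ss K cap : nat) :
  0 < d -> 0 < s -> 0 < l -> 4 <= k -> l <= s * d -> k < s * d ->
  n = n' * d -> n = a + b -> n <= s * d * a -> s * d * a < n + s * d ->
  aP <= a + rB -> a <= aP + rA -> a <= nB + q -> nB <= a + rB -> q <= rA ->
  v0 <= rA + rB -> np = s * q -> sz = np * l + mP * d -> np <= mP -> mP <= np * ss ->
  cap = (s * (l + ss * d) + 2 * k * (1 + s * (1 + ss) + s + 2)) * (rA + rB).+1 ->
  20 * (k * (s * d) * cap) <= n -> 24 * K * (s * d) <= n ->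
  let t := s * nB + mP - n' in
  [/\ s * nB + mP = n' + t, sz + (v0 + t + 2) * (2 * k) <= cap,
      3 * (np + v0 + t + 2) + t + 2 <= aP, 3 * cap + aP * l <= 3 * (n %/ 2)
    & [/\ 3 * n <= 6 * (s * d) * (aP - t - 2), 12 * K <= aP - t - 2
        & n <= 8 * (b - rB - n %/ 2)]].
Proof.
move=> d0 s0 l0 k4 lsd ksd nE nab na an aPle aPge anB nBle qr v0r npE szE npm mps capE hW hK t.
have sd0 : 0 < s * d by rewrite muln_gt0 s0.
have san : n' <= s * a.
  by rewrite -(leq_pmul2r d0) -nE (leq_trans na) // mulnAC.
have asn : s * a < n' + s.
  by rewrite -(ltn_pmul2r d0) mulnDl -nE mulnAC.
have h1 : s * a <= s * nB + s * q by rewrite -mulnDr leq_mul2l anB orbT.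
have t1 : s * nB + mP = n' + t by rewrite /t subnKC //; clear -h1 san npE npm; lia.
have h2 : s * nB <= s * a + s * rB by rewrite -mulnDr leq_mul2l nBle orbT.
have t2 : t <= s + s * rB + s * q * ss.
  by rewrite -npE; clear -t1 h2 asn mps; lia.
set r := rA + rB in capE v0r.
have rBr : s * rB <= s * r by rewrite leq_mul2l leq_addl orbT.
have qr' : q <= r by apply: leq_trans qr (leq_addr _ _).
have sqr : s * q <= s * r by rewrite leq_mul2l qr' orbT.
have sqr2 : s * q * ss <= s * r * ss by rewrite leq_mul2r sqr orbT.
have c2 : sz + (v0 + t + 2) * (2 * k) <= cap.
  have e1 : sz <= s * (l + ss * d) * r.+1.
    have : sz <= s * q * (l + ss * d).
      rewrite szE mulnDr -npE leq_add2l mulnA leq_mul2r mps orbT //.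
    by move=> /leq_trans; apply; rewrite mulnAC leq_mul2l (leq_trans qr') ?orbT.
  have e2 : v0 + t + 2 <= (1 + s * (1 + ss) + s + 2) * r.+1.
    have : v0 + t + 2 <= r + s + s * r + s * r * ss + 2 by clear -v0r t2 rBr sqr2; lia.
    by move=> /leq_trans; apply; clear; nia.
  rewrite capE [leqRHS]mulnDl leq_add // -mulnA [leqRHS]mulnC.
  by rewrite [leqRHS]mulnC [leqLHS]mulnC leq_mul2l e2 orbT.
set X := k * (s * d) * cap in hW.
have cap0 : r.+1 <= cap.
  by rewrite capE leq_pmull // addn_gt0; apply/orP; right; rewrite !muln_gt0; clear -k4; lia.
have k0 : 0 < k by clear -k4; lia.
have X1 : k * cap <= X by rewrite /X leq_mul2r leq_pmulr ?orbT.
have X2 : s * d * cap <= X by rewrite /X leq_mul2r leq_pmull ?orbT.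
have X3 : cap <= k * cap by rewrite leq_pmull.
have X4 : s * d <= s * d * cap by rewrite leq_pmulr //; apply: leq_trans cap0.
have np_le : np <= sz by rewrite szE; apply: leq_trans (leq_addr _ _); rewrite leq_pmulr.
have v_le : v0 + t + 2 <= (v0 + t + 2) * (2 * k) by rewrite leq_pmulr // muln_gt0.
have a5 : 5 * cap <= a.
  rewrite -(leq_pmul2l sd0); apply: leq_trans na; clear -hW X2; lia.
have rAr : rA <= r by rewrite leq_addr.
have rBr' : rB <= r by rewrite leq_addl.
have aPt : a <= aP - t - 2 + 2 * cap.
  by clear -aPge c2 v_le cap0 rAr; lia.
have t2cap : t + 2 <= cap by clear -c2 v_le; lia.
split=> //.
- by clear -np_le c2 v_le a5 aPge cap0 rAr; lia.
- have al : a * l <= n + s * d.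
    rewrite -(leq_pmul2l sd0) mulnA [leqRHS]mulnC; apply: leq_mul => //; exact: ltnW.
  have rl : rB * l <= k * cap + s * d * cap.
    apply: leq_trans (leq_addl _ _); rewrite mulnC; apply: leq_mul => //.
    by apply: leq_trans rBr' (ltnW cap0).
  have : aP * l <= a * l + rB * l by rewrite -mulnDl leq_mul2r aPle orbT.
  clear -al rl hW X1 X2 X3 X4 cap0 sd0; lia.
split.
- have h3 : a <= 2 * (aP - t - 2) by clear -aPt a5; lia.
  have h4 : s * d * a <= s * d * (2 * (aP - t - 2)) by rewrite leq_mul2l h3 orbT.
  clear -h4 na; lia.
- have a24 : 24 * K <= a.
    by rewrite -(leq_pmul2l sd0) mulnC; apply: leq_trans hK na.
  clear -a24 aPt a5; lia.
have h5 : 5 * a <= s * d * a by rewrite leq_mul2r; apply/orP; right; clear -ksd k4; lia.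
clear -h5 an nab hW X1 X2 X3 X4 cap0 rBr'; lia.
Qed.

Lemma size_flatten_affine (T : eqType) (l d : nat) (f : seq T -> nat) (ps : seq (seq T)) :
  (forall p, p \in ps -> size p = l + f p * d) ->
  size (flatten ps) = size ps * l + (\sum_(p <- ps) f p) * d.
Proof.
elim: ps => [|p ps IH] h; first by rewrite big_nil.
rewrite /= size_cat h ?mem_head // IH; last by move=> p' hp'; rewrite h // inE hp' orbT.
rewrite big_cons mulSn mulnDl; lia.
Qed.

Lemma uniq_flatten_disjoint (I : eqType) (T : finType) (P : I -> seq T) (r : seq I) :
  uniq r -> (forall i, uniq (P i)) -> (forall i j, i != j -> [disjoint P i & P j]) ->
  uniq (flatten [seq P i | i <- r]).
Proof.
move=> + uP dP; elim: r => [|i r IH] //= /andP[ir ur].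
rewrite cat_uniq uP IH // andbT; apply/hasPn => x /flatten_mapP[j jr xj].
have /dP dij : i != j by apply: contraNneq ir => ->.
by rewrite (disjointFl dij).
Qed.

Lemma min_codeg_le (V : finType) (k : nat) (E : {set {set V}}) (S : {set V}) :
  #|S| = k.-1 -> min_codeg k E <= codeg E S.
Proof.
move=> /eqP cS; rewrite /min_codeg.
elim: (index_enum _) (mem_index_enum S) => // S' r IH; rewrite inE big_cons.
case/predU1P => [<-|/IH h]; first by rewrite cS geq_minl.
by case: ifP => // _; rewrite (leq_trans (geq_minr _ _)).
Qed.

Lemma s_of_params (k l : nat) : 2 <= l -> l < k -> ~~ ((k - l) %| k) ->
  path_params k l (s_of k l) (k - l).
Proof.
move=> l2 lk nd; set d := k - l in nd *.
have d0 : 0 < d by rewrite subn_gt0.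
have hk := divn_eq k d; have hm := ltn_pmod k d0.
have m0 : 0 < k %% d by rewrite lt0n.
have sE : s_of k l = (k %/ d).+1.
  rewrite /s_of /ceil_div -/d {1}hk -addnA divnMDl // -addn1; congr (_ + _).
  rewrite (_ : _ + _ = 1 * d + (k %% d).-1) ?divnMDl ?divn_small //; last by lia.
  by lia.
have q1 : 0 < k %/ d by rewrite divn_gt0 // leq_subr.
split=> //.
- rewrite ltnNge; apply/negP => d1; have dE : d = 1 by lia.
  by rewrite dE dvd1n in nd.
- by rewrite sE.
- by rewrite subnKC // ltnW.
- by rewrite sE mulSn; lia.
Qed.

(** * Choice of the constants *)

Lemma exists_nat_ge (R : realType) (x y : R) : (0 < x)%R ->
  exists N : nat, forall n : nat, N <= n -> (y <= x * n%:R)%R.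
Proof.
move=> x0; exists (Num.bound `|y / x|%R) => n hn.
rewrite -ler_pdivrMl // mulrC; apply: le_trans (ler_norm _) _.
by apply: le_trans (ltW (archi_boundP (normr_ge0 _))) _; rewrite ler_nat.
Qed.

(** In every inequality the smaller side has the higher power of [e], so [e <= 1 / G] suffices once
    [G] is at least all coefficients that occur. *)
Lemma small_eps_constants (R : realType) (Q P C D W Cb L H : nat) :
  exists2 g : R, (0 < g)%R & forall e : R, (0 < e)%R -> (e <= g)%R ->
  [/\ (e < 1 / 2%:R)%R, (C%:R * e ^+ 3 < 1)%R,
      (Q%:R * (P%:R * e + 2%:R * (C%:R * e ^+ 3)) <= 1)%R,
      (4%:R * D%:R * (C%:R * e ^+ 3) <= e ^+ 2)%R
    & [/\ (W%:R * e ^+ 2 <= 1)%R, (4%:R * Cb%:R * e ^+ 2 <= e)%R,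
          (4%:R * Cb%:R * (L%:R * (C%:R * e ^+ 3)) <= e)%R
        & (H%:R * (L%:R * (C%:R * e ^+ 3)) < 1)%R]].
Proof.
pose G := 4 + 2 * C + 2 * (Q * P) + 4 * (Q * C) + 4 * (D * C) + W + 4 * Cb
  + 4 * (Cb * (L * C)) + 2 * (H * (L * C)).
have g0 : 4 <= G by rewrite /G; clear; lia.
have g1 : 2 * C <= G by rewrite /G; clear; lia.
have g2 : 2 * (Q * P) <= G by rewrite /G; clear; lia.
have g3 : 4 * (Q * C) <= G by rewrite /G; clear; lia.
have g4 : 4 * (D * C) <= G by rewrite /G; clear; lia.
have g5 : W <= G by rewrite /G; clear; lia.
have g6 : 4 * Cb <= G by rewrite /G; clear; lia.
have g7 : 4 * (Cb * (L * C)) <= G by rewrite /G; clear; lia.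
have g8 : 2 * (H * (L * C)) <= G by rewrite /G; clear; lia.
have G0 : (0 < G%:R :> R)%R by rewrite ltr0n; apply: leq_trans g0.
clearbody G.
exists (G%:R^-1)%R; first by rewrite invr_gt0.
move=> e e0 eg.
have eG : (e * G%:R <= 1)%R by rewrite -ler_pdivlMr // mul1r.
have h X : X <= G -> (e * X%:R <= 1)%R.
  by move=> XG; apply: le_trans eG; rewrite ler_pM2l // ler_nat.
have h4 : (e * 4%:R <= 1)%R by apply: h g0.
have e1 : (e <= 1)%R by lra.
have e2 : (e ^+ 2 <= e)%R by rewrite expr2 ler_piMr // ltW.
have e2' : (0 < e ^+ 2)%R by rewrite exprn_gt0.
have e3 : (e ^+ 3 = e * e ^+ 2)%R by rewrite exprS.
have e32 : (e ^+ 3 <= e)%R by rewrite e3 ler_piMr ?ltW //; apply: le_lt_trans e2 _; lra.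
have e30 : (0 < e ^+ 3)%R by rewrite exprn_gt0.
have nat0 (X : nat) : (0 <= X%:R :> R)%R by [].
have hC : (e * (2%:R * C%:R) <= 1)%R by rewrite -natrM; apply: h g1.
have hQP : (e * (2%:R * (Q%:R * P%:R)) <= 1)%R by rewrite -!natrM; apply: h g2.
have hQC : (e * (4%:R * (Q%:R * C%:R)) <= 1)%R by rewrite -!natrM; apply: h g3.
have hDC : (e * (4%:R * (D%:R * C%:R)) <= 1)%R by rewrite -!natrM; apply: h g4.
have hW : (e * W%:R <= 1)%R by apply: h g5.
have hCb : (e * (4%:R * Cb%:R) <= 1)%R by rewrite -!natrM; apply: h g6.
have hCL : (e * (4%:R * (Cb%:R * (L%:R * C%:R))) <= 1)%R.
  by rewrite -!natrM; apply: h g7.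
have hHL : (e * (2%:R * (H%:R * (L%:R * C%:R))) <= 1)%R.
  by rewrite -!natrM; apply: h g8.
have mul X : (0 <= X)%R -> (X * e ^+ 3 <= X * e)%R by move=> X0; rewrite ler_wpM2l.
split; [lra| | | |split].
- have := mul C%:R%R (nat0 _); lra.
- have := mul (Q%:R * C%:R)%R (mulr_ge0 (nat0 _) (nat0 _)).
  set E3 := (e ^+ 3)%R; rewrite mulrDr; lra.
- rewrite e3 (_ : _ * _ = e * (4%:R * (D%:R * C%:R)) * e ^+ 2)%R; last by ring.
  by rewrite -[leRHS]mul1r ler_pM2r.
- by apply: le_trans hW; rewrite mulrC ler_wpM2r.
- rewrite expr2 (_ : _ * _ = e * (4%:R * Cb%:R) * e)%R; last by ring.
  by rewrite -[leRHS]mul1r ler_pM2r.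
- have := mul (4%:R * (Cb%:R * (L%:R * C%:R)))%R.
  rewrite e3 (_ : 4%:R * _ * _ = e * (4%:R * (Cb%:R * (L%:R * C%:R))) * e ^+ 2)%R; last by ring.
  move=> _; apply: le_trans e2; rewrite -[leRHS]mul1r ler_pM2r //.
- have := mul (H%:R * (L%:R * C%:R))%R (mulr_ge0 (nat0 _) (mulr_ge0 (nat0 _) (nat0 _))).
  by rewrite !mulrA in hHL *; move: hHL; set E3 := (e ^+ 3)%R; lra.
Qed.

(** Clearing the floor: the complement of [B] has size [#|V| / (s_of k l * (k - l))] rounded up. *)
Lemma B_size_bounds (R : realType) (k l : nat) (V : finType) (B : {set V}) :
  0 < s_of k l * (k - l) -> has_B_size k l R B ->
  #|V| <= s_of k l * (k - l) * (#|V| - #|B|)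
       < #|V| + s_of k l * (k - l).
Proof.
rewrite /has_B_size /density; set m := s_of k l * (k - l); set n := #|V| => m0 hB.
have Bn : #|B| <= n by apply: max_card.
have m0R : (0 < m%:R :> R)%R by rewrite ltr0n.
have /andP[] := floor_itv ((1 - m%:R^-1) * n%:R : R)%R; rewrite -hB => h1 h2.
have {}h1 : (#|B|%:R * m%:R <= (m%:R - 1) * n%:R :> R)%R.
  rewrite -ler_pdivlMr // mulrAC mulrBl mulfV ?gt_eqF // mul1r.
  by move: h1; rewrite pmulrn.
have {}h2 : ((m%:R - 1) * n%:R < (#|B|%:R + 1) * m%:R :> R)%R.
  rewrite -ltr_pdivrMr // mulrAC mulrBl mulfV ?gt_eqF // mul1r.
  by move: h2; rewrite intrD pmulrn.
have e : ((m * (n - #|B|))%:R = m%:R * n%:R - m%:R * #|B|%:R :> R)%R.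
  by rewrite natrM natrB // mulrBr.
rewrite -(ler_nat R) -(ltr_nat R) natrD e; apply/andP; split; lra.
Qed.

(** Codegrees are integers, so the lower bound [n / m] may be rounded up, and [a] does not exceed
    the rounded value. *)
Lemma codeg_lower_bound (R : realType) (k a m n : nat) (V : finType) (E : {set {set V}}) :
  0 < m -> m * a < n + m -> (n%:R / m%:R <= (min_codeg k E)%:R :> R)%R ->
  forall S : {set V}, #|S| = k.-1 -> a <= codeg E S.
Proof.
move=> m0 am h S cS; apply: leq_trans (min_codeg_le E cS).
move: h; rewrite ler_pdivrMr ?ltr0n // -natrM ler_nat => h.
have : m * a < m * (min_codeg k E).+1.
  by apply: leq_trans am _; rewrite mulnS addnC leq_add2l mulnC.
by rewrite ltn_pmul2l.
Qed.

(** The bound on [Delta] makes [eps0] at most [g ^+ 4], and [Delta <= eps0] because [density] is at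
    most 1. Both pass to [eps1] through [eps1 ^+ 4 = eps0]. *)
Lemma eps1_bounds (R : realType) (k l : nat) (g Delta : R) :
  1 < s_of k l * (k - l) -> (0 < g)%R -> (0 < Delta)%R ->
  (Delta <= g ^+ 4 * density k l R ^+ k / (2%:R * (k`!)%:R))%R ->
  [/\ (0 < eps1 k l Delta)%R, (eps1 k l Delta <= g)%R
    & (Delta <= eps1 k l Delta ^+ 4)%R].
Proof.
move=> m1 g0 D0 Dle.
have [m0 m1R] : (0 < (s_of k l * (k - l))%:R :> R)%R /\ (1 < (s_of k l * (k - l))%:R :> R)%R.
  by rewrite ltr0n ltr1n (ltnW m1).
have d0 : (0 < density k l R)%R by rewrite subr_gt0 invf_lt1.
have d1 : (density k l R <= 1)%R by rewrite gerBl invr_ge0 ltW.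
have f0 : (0 < 2%:R * (k`!)%:R :> R)%R by rewrite mulr_gt0 ?ltr0n ?fact_gt0.
have dk : (0 < density k l R ^+ k)%R by rewrite exprn_gt0.
have e0 : (0 < eps0 k l Delta)%R by rewrite /eps0 !mulr_gt0 ?invr_gt0 ?ltr0n ?fact_gt0.
have e4 : (eps1 k l Delta ^+ 4 = eps0 k l Delta)%R.
  by rewrite /eps1 -powR_mulrn ?powR_ge0 // -powRrM mulVf ?powRr1 ?ltW // pnatr_eq0.
have p0 : (0 < eps1 k l Delta)%R by rewrite powR_gt0.
split=> //.
- rewrite -(@ler_pXn2r _ 4) ?nnegrE ?(ltW p0) ?(ltW g0) // e4 /eps0 ler_pdivrMr // mulrC.
  by move: Dle; rewrite ler_pdivlMr.
- rewrite e4 /eps0 mulrAC -[leLHS]mul1r ler_pM2r //.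
  apply: (@le_trans _ _ (2%:R * (k`!)%:R)%R).
    by rewrite -natrM ler1n muln_gt0 fact_gt0.
  by rewrite ler_peMr ?(ltW f0) // invf_ge1 // exprn_ile1 // ltW.
Qed.

Lemma piece_of_lpath (R : realType) (V : finType) (k l : nat) (E : {set {set V}})
    (e : R) (B W : {set V}) (p : seq V) : path_params k l (s_of k l) (k - l) ->
  contains_lpath k l (induced E W) W p ->
  linkable k l E e B (path_end_left l p) -> linkable k l E e B (path_end_right l p) ->
  piece k l (s_of k l) (k - l) E (good k E e B) p.
Proof.
case=> d2 s2 l2 kE _ [[up _ sp] _ wp] [_ _ okl] [_ _ okr].
split=> //.
- by rewrite sp leq_addr.
- by rewrite sp addKn dvdn_mull.
- move=> i hi; have : path_edge k l p i \in induced E W.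
    apply: wp; rewrite -(ltn_pmul2r (ltnW d2)); move: hi; rewrite sp {2}kE.
    by clear -d2; lia.
  by rewrite inE => /andP[].
move=> i i1; have hi : 1 <= i.+1 <= (s_of k l).-1 by clear -i1; lia.
split; first exact: okr hi.
(* The left end is read outward, so dropping its first entries leaves a prefix of [p], reversed. *)
have := okl _ hi; rewrite /path_end_left drop_rev /=; congr good.
apply/setP => x; rewrite !inE mem_rev size_takel; last by rewrite sp leq_addr.
by rewrite take_takel // leq_subr.
Qed.

Lemma quarter_split (R : realType) (C a p x y n e : R) : (0 <= C)%R -> (0 <= n)%R -> (0 <= e)%R ->
  (4%:R * C * a <= e * n)%R -> (p <= y * n)%R -> (4%:R * C * y <= e)%R ->
  (4%:R * C * x <= e)%R -> (C * (a + p + x * n) <= e * n)%R.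
Proof.
move=> C0 n0 e0 h1 h2 h3 h4; have en0 := mulr_ge0 e0 n0.
have g2 := ler_wpM2l C0 h2; have g3 := ler_wpM2r n0 h3; have g4 := ler_wpM2r n0 h4.
rewrite !mulrDr; rewrite -!mulrA in h1 g2 g3 g4 *; lra.
Qed.

Lemma bin_ge_half (k b n : nat) : k <= b -> n <= 2 * b ->
  forall j, j <= k -> n ^ j <= (2 * k) ^ k * 'C(b, j).
Proof.
move=> kb nb j jk; have [->|j0] := posnP j.
  by rewrite expn0 bin0 muln1 expn_gt0; case: k {kb jk}.
apply: (@leq_trans ((2 * b) ^ j)); first by rewrite leq_exp2r.
rewrite expnMn; apply: (@leq_trans (2 ^ j * (j ^ j * 'C(b, j)))).
  by rewrite leq_mul2l exp_leq_bin ?orbT // (leq_trans jk).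
rewrite mulnA leq_mul2r -expnMn; apply/orP; right.
apply: (@leq_trans ((2 * k) ^ j)); first by rewrite leq_exp2r // leq_mul2l jk orbT.
by rewrite leq_pexp2l // muln_gt0 (leq_trans j0 jk).
Qed.

Theorem theorem3p1 (R : realType) (k l : nat) (sstar : nat -> nat)
    (hl : 2 <= l) (hlk : l < k) (hndvd : ~~ ((k - l) %| k)) :
  exists2 Delta0 : R, (0 < Delta0)%R &
  forall Delta : R, (0 < Delta)%R -> (Delta <= Delta0)%R ->
  exists n0 : nat, forall n : nat, n0 <= n -> (k - l) %| n ->
  forall (V : finType) (E : {set {set V}}),
    #|V| = n ->
    kgraph k E ->
    extremal k l E Delta ->
    (n%:R / (s_of k l * (k - l))%:R <= (min_codeg k E)%:R :> R)%R ->
  forall A B : {set V},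
    A :|: B = [set: V] -> A :&: B = set0 ->
    has_B_size k l R B ->
    (forall C : {set V}, has_B_size k l R C -> nedges E B <= nedges E C) ->
  let e1 := eps1 k l Delta in
  let Bp := B' k E e1 B in
  let q := #|A :&: Bp| in
  (exists P : 'I_(s_of k l * q) -> seq V,
     [/\ forall i, contains_lpath k l (induced E Bp) Bp (P i),
         forall i, path_length k l (P i) <= sstar k,
         forall i, linkable k l E e1 B (path_end_left l (P i))
                   /\ linkable k l E e1 B (path_end_right l (P i))
       & forall i j, i != j -> [disjoint P i & P j]]) ->
  hamilton_lcycle k l E.
Proof.
have par := s_of_params hl hlk hndvd.
have [d_ge2 s_ge2 _ def_k /andP[k_lt_sd sd_lt_kd]] := par.
set s := s_of k l in par s_ge2 k_lt_sd sd_lt_kd *.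
set d := k - l in par d_ge2 def_k k_lt_sd sd_lt_kd.
(* At least [#|A| / 2] vertices of [A'] go into connectors, three into each, and
   [#|A| >= n / (s * d)]; so [c] bounds the ratio of [n] to the number of connectors. *)
pose K := conn_size l s d; pose c := 6 * (s * d).
pose Q := 4 * K.+1 * (3 * s * k ^ k * c ^ K.-1).
(* [D * r.+1], with [r] the number of atypical vertices, bounds the vertices of the pieces with
   edges: the first summand is for the given paths, the second for the gadgets. *)
pose D := s * (l + sstar k * d) + 2 * k * (1 + s * (1 + sstar k) + s + 2).
pose Cb := (2 * k) ^ k.
have [g g0 gP] := small_eps_constants R Q (2 ^ k) (Cb * 2 ^ k) D (20 * (k * (s * d))) Cb
  l.+2 ((8 * k) ^ k).
have d0 : 0 < d by exact: ltnW.
have s0 : 0 < s by exact: ltnW.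
have l0 : 0 < l by exact: ltnW.
have k4 : 4 <= k by clear -def_k d_ge2 hl; lia.
have k2 : 2 < k by exact: ltnW.
have l2k : l.+2 <= k by clear -def_k d_ge2; lia.
have sd0 : 0 < s * d by rewrite muln_gt0 s0.
have sd1 : 1 < s * d by exact: leq_trans (ltnW (ltnW k4)) (ltnW k_lt_sd).
have lsd : l <= s * d by exact: leq_trans (ltnW hlk) (ltnW k_lt_sd).
(* The value of [Delta] at which [eps0] equals [g ^+ 4]. *)
exists (g ^+ 4 * density k l R ^+ k / (2%:R * (k`!)%:R))%R.
  have dens0 : (0 < density k l R)%R.
    by rewrite subr_gt0 invf_lt1 ?ltr0n // ltr1n.
  by rewrite !mulr_gt0 ?invr_gt0 ?mulr_gt0 ?exprn_gt0 ?ltr0n ?fact_gt0.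
move=> Delta D0 Dle.
have [e0 eg De4] := eps1_bounds sd1 g0 D0 Dle.
set e := eps1 k l Delta in e0 eg De4 *.
have [e_lt C_lt1 Q_small D_small [W_small Cb_small CL_small H_small]] := gP e e0 eg.
have e2_gt0 : (0 < e ^+ 2)%R by rewrite exprn_gt0.
have [N1 hN1] := exists_nat_ge (2%:R * D%:R)%R e2_gt0.
have [N2 hN2] := exists_nat_ge (4%:R * Cb%:R * (2 * k)%:R)%R e0.
exists (N1 + N2 + 24 * K.+1 ^ 2 * (s * d) + 8 * k + 4 * (s * d)).
move=> n n_ge dn V E card_V kE [B0 B0_size B0_edges] codeg_min A B AB_T AB_0 B_size B_min.
move=> e1 Bp q [P [P_path P_len P_link P_disj]].
have nN1 : N1 <= n by clear -n_ge; lia.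
have nN2 : N2 <= n by clear -n_ge; lia.
have n24 : 24 * K.+1 ^ 2 * (s * d) <= n.
  apply: leq_trans n_ge; apply: leq_trans (leq_addl _ _) _.
  exact: leq_trans (leq_addr _ _) (leq_addr _ _).
have n8k : 8 * k <= n by clear -n_ge; lia.
have n4sd : 4 * (s * d) <= n by apply: leq_trans n_ge; apply: leq_addl.
have n_gt0 : 0 < n by apply: leq_trans n8k; rewrite muln_gt0 (leq_trans _ k4).
have cAB : n = #|A| + #|B|.
  by rewrite -card_V -cardsT -AB_T cardsU AB_0 cards0 subn0.
have /andP[] := B_size_bounds sd0 B_size; rewrite card_V cAB addnK -cAB => na an.
have codeg_ge : forall S : {set V}, #|S| = k.-1 -> #|A| <= codeg E S.
  exact: codeg_lower_bound sd0 an codeg_min.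
(* Minimality of [B] transfers the bound from the set that witnesses extremality. *)
have few_edges : ((nedges E B)%:R <= e ^+ 4 * #|V|%:R ^+ k)%R.
  apply: (@le_trans _ _ (nedges E B0)%:R%R); first by rewrite ler_nat B_min.
  by apply: le_trans B0_edges _; rewrite ler_wpM2r ?exprn_ge0.
have a4 : 4 * #|A| <= s * d * #|A| by rewrite leq_mul2r (leq_trans k4) ?orbT // ltnW.
have nB2 : n <= 2 * #|B| by clear -a4 an cAB n4sd; lia.
have kB : k <= #|B| by clear -nB2 n8k; lia.
have bin_ge : forall j, j <= k -> #|V| ^ j <= Cb * 'C(#|B|, j).
  by rewrite card_V; apply: bin_ge_half.
have V_gt0 : 0 < #|V| by rewrite card_V.
pose Ap := A' k E e B.
pose r := #|A :\: Ap| + #|B :\: Bp|.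
pose cap := D * r.+1.
have r_le : (r%:R <= 2%:R * ((Cb * 2 ^ k)%:R * e ^+ 3) * n%:R :> R)%R.
  by rewrite -card_V; apply: card_minus_le.
have nR0 : (0 <= n%:R :> R)%R by [].
have cap_le : (cap%:R <= e ^+ 2 * n%:R :> R)%R.
  have h1 := hN1 n nN1.
  have h2 := ler_wpM2r nR0 D_small.
  have h3 := ler_wpM2l (ler0n R D) r_le.
  rewrite /cap natrM -addn1 natrD mulrDr mulr1.
  move: h1 h2 h3; set x := ((Cb * 2 ^ k)%:R * e ^+ 3)%R; set y := (e ^+ 2 * n%:R)%R.
  rewrite (_ : 4%:R * D%:R * x * n%:R = 2%:R * (D%:R * (2%:R * x * n%:R)))%R; last by ring.
  lra.
have W_cap : 20 * (k * (s * d) * cap) <= n.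
  rewrite -(ler_nat R) mulnA natrM.
  apply: (@le_trans _ _ ((20 * (k * (s * d)))%:R * (e ^+ 2 * n%:R))%R).
    by rewrite ler_wpM2l.
  by rewrite mulrA ler_piMl.
have few_Ap := few_nonedges_Ap kE AB_T AB_0 codeg_ge k2 V_gt0 bin_ge few_edges e0 e_lt Q_small.
have few_ok := few_nonedges_ok kE AB_T AB_0 codeg_ge k2 l2k V_gt0 bin_ge few_edges e0 e_lt Q_small.
have links : (Cb%:R * ((2 * k)%:R + cap%:R + l.+2%:R * ((Cb * 2 ^ k)%:R * e ^+ 3) * #|V|%:R)
    <= e * #|V|%:R)%R.
  by rewrite card_V; apply: quarter_split (ltW e0) (hN2 n nN2) cap_le Cb_small CL_small.
have disj : [disjoint Ap & Bp] := @disjoint_ApBp R V k E B e V_gt0 bin_ge e_lt.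
have in_AB x : (x \in A) || (x \in B) by rewrite -in_setU AB_T inE.
have qA : q <= #|A :\: Ap|.
  apply: subset_leq_card; apply/subsetP => x; rewrite in_setI => /andP[xA xB].
  by rewrite in_setD xA (disjointFl disj xB).
have anB : #|A| <= #|~: Bp| + q.
  rewrite -(cardsID Bp A) addnC leq_add2r; apply: subset_leq_card.
  by apply/subsetP => x; rewrite in_setD in_setC => /andP[].
have nBle : #|~: Bp| <= #|A| + #|B :\: Bp|.
  apply: leq_trans (leq_card_setU _ _); apply: subset_leq_card; apply/subsetP => x.
  by rewrite in_setC in_setU in_setD => ->; apply: in_AB.
have aPle : #|Ap| <= #|A| + #|B :\: Bp|.
  apply: leq_trans nBle; apply: subset_leq_card; apply/subsetP => x xA.
  by rewrite in_setC (disjointFr disj xA).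
have aPge : #|A| <= #|Ap| + #|A :\: Ap|.
  by rewrite -(cardsID Ap A) leq_add2r subset_leq_card // subsetIr.
have v0r : #|~: (Ap :|: Bp)| <= r.
  apply: leq_trans (leq_card_setU _ _); apply: subset_leq_card; apply/subsetP => x.
  rewrite in_setC !in_setU negb_or !in_setD => /andP[-> ->]; exact: in_AB.
pose ps := [seq P i | i <- enum 'I_(s * q)].
have size_ps : size ps = s * q by rewrite size_map -cardE card_ord.
have ps_len p : p \in ps -> size p = l + path_length k l p * d.
  by case/mapP => i _ ->; have [[_ _ ->]] := P_path i.
pose mP := \sum_(p <- ps) path_length k l p.
have flat_ps := size_flatten_affine ps_len.
have mP_ge : size ps <= mP.
  rewrite -sum1_size /mP !big_map; apply: leq_sum => i _.
  by have [[]] := P_path i.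
have mP_le : mP <= size ps * sstar k.
  rewrite /mP big_map; apply: (@leq_trans (\sum_(i <- enum 'I_(s * q)) sstar k)).
    by apply: leq_sum => i _; apply: P_len.
  by rewrite size_map big_const_seq count_predT iter_addn_0 mulnC.
have nE : n = n %/ d * d by rewrite divnK.
have [t1 c2 c3 c4 [c5 c6 c7]] := assembly_numerics d0 s0 l0 k4 lsd k_lt_sd nE cAB na an
  aPle aPge anB nBle qA v0r size_ps flat_ps mP_ge mP_le (erefl cap) W_cap n24.
have avail := available_links kE k2 l2k V_gt0 bin_ge few_edges e0 links.
(* The pieces with edges and at most [#|Ap| / 3] bare tuples together occupy at most half of the
   vertices. *)
have bare : forall U : {set V}, #|U| <= n %/ 2 ->
  exists W : {set V}, [/\ #|W| = l, W \subset Bp :\: U & clean l (good k E e B) W].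
  apply: (available_clean kE k2 l2k V_gt0 bin_ge few_edges e0); rewrite ?card_V //.
  apply: le_lt_trans H_small; rewrite ler_wpM2l // ler_wpM2r ?ler_nat //.
  by rewrite mulr_ge0 // exprn_ge0 // ltW.
have ok0 := ok_set0 kE V_gt0 bin_ge few_edges e0 C_lt1.
have ok1 := @ok_set1 R V k E B e.
apply: (hamilton_assembly par ok0 ok1 few_Ap few_ok avail bare disj (c := c)
  _ _ _ flat_ps _ t1 c2 c3 c4 _ _ (leqnn Q)).
- by move=> _ /mapP[i _ ->]; have [h1 h2] := P_link i; apply: piece_of_lpath h1 h2.
- apply: uniq_flatten_disjoint; rewrite ?enum_uniq // => i.
  by have [[]] := P_path i.
- by move=> x /flattenP[_ /mapP[i _ ->]]; have [_ h _] := P_path i; apply: h.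
- by rewrite card_V.
- by rewrite card_V.
- by rewrite mulnA.
Qed.
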